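(* Let $(G,\sigma)$ be a connected cubic signed graph such that $G$ is $3$-edge-colorable, and let $E_N(G,\sigma)$ be the set of negative edges of $(G,\sigma)$. Let $R,B,Y$ be the three color classes of a proper $3$-edge-coloring of $G$ such that $|R\cap E_N(G,\sigma)|\equiv|B\cap E_N(G,\sigma)|\pmod 2$. Suppose $(G,\sigma)$ is flow-admissible. Then $(G,\sigma)$ has a nowhere-zero $8$-flow, unless $R\cup B$ contains no unbalanced circuits and the numbers of unbalanced circuits in $R\cup Y$ and in $B\cup Y$ are both odd and at least $3$; in this exceptional case $(G,\sigma)$ has a nowhere-zero $10$-flow.
   Context: Graphs are finite and may have multiple edges or loops. A signed graph $(G,\sigma)$ is a graph $G$ with a signature $\sigma:E(G)\to\{+1,-1\}$; an edge $e$ is negative if $\sigma(e)=-1$. A graph is cubic if every vertex has degree $3$ (a loop contributes $2$ to the degree), and $3$-edge-colorable if it has a proper edge-coloring with three colors. In a cubic graph each color class of such a coloring is a perfect matching, so the union of two color classes is the edge set of a $2$-factor, i.e. a disjoint union of circuits; ''circuits in $R\cup B$'' (and similarly for the other pairs) means the circuits of this $2$-factor. A circuit (connected $2$-regular subgraph) is unbalanced if it contains an odd number of negative edges, and balanced otherwise. Each edge $e=uv$ is regarded as two half edges $h_e^u$ (incident with $u$) and $h_e^v$ (incident with $v$); a loop at $v$ gives two half edges both incident with $v$. $H(v)$ is the set of half edges incident with $v$, $H(G)$ is the set of all half edges, and $e_h$ denotes the edge containing the half edge $h$. An orientation of $(G,\sigma)$ is a mapping $\tau:H(G)\to\{+1,-1\}$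 such that $\tau(h_e^u)\tau(h_e^v)=-\sigma(e)$ for every edge $e=uv$. For an integer $k\ge 2$, a $k$-flow of $(G,\sigma)$ is a pair $(\tau,f)$ where $\tau$ is an orientation and $f:E(G)\to\mathbb{Z}$ satisfies $|f(e)|\le k-1$ for every edge $e$ and $\sum_{h\in H(v)}\tau(h)f(e_h)=0$ for every vertex $v$. It is nowhere-zero if $f(e)\neq 0$ for every $e\in E(G)$. A signed graph is flow-admissible if it admits a nowhere-zero $k$-flow for some integer $k$. *)

(* Defs.v *)
From HB Require Import structures.
From mathcomp Require Import all_boot all_order all_algebra.

Set Implicit Arguments.
Unset Strict Implicit.
Unset Printing Implicit Defensive.

Import Order.TTheory GRing.Theory Num.Theory.
Local Open Scope ring_scope.

(* Finite graphs with parallel edges and loops allowed.  The boolean only names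
   the two ends of an edge; the order it puts on them carries no meaning. *)
Record mgraph := MGraph {
  vert : finType;
  edge : finType;
  ends : edge -> bool -> vert
}.

Section Graphs.
Variable G : mgraph.
Implicit Types (v w : vert G) (e : edge G) (C F : {set edge G}).

(* [(e, b)] is the half of [e] incident with [ends e b]; [h.1] is thus the edge
   containing [h], and a loop has two half edges at its vertex. *)
Definition half : finType := (edge G * bool)%type.
Definition inc (h : half) : vert G := ends h.1 h.2.

Definition half_at v : {set half} := [set h : half | inc h == v].

Definition cubic : Prop := forall v, #|half_at v| = 3%N.

Definition deg_in F v : nat := #|[set h in half_at v | h.1 \in F]|.

Definition adj_in F : rel (vert G) := fun v w =>
  [exists e in F, exists b, (ends e b == v) && (ends e (~~ b) == w)].

Definition connected : Prop :=
  (0 < #|vert G|)%N /\ forall v w, connect (adj_in setT) v w.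

(* Stated on half edges, so that a graph with a loop has no proper coloring. *)
Definition proper_edge_coloring (k : nat) (c : edge G -> 'I_k) : Prop :=
  forall h h' : half, h != h' -> inc h = inc h' -> c h.1 != c h'.1.

Definition color_class (k : nat) (c : edge G -> 'I_k) (i : nat) :
  {set edge G} := [set e | c e == i :> nat].

(* A connected 2-regular subgraph, given by its edge set; its vertices are the
   vertices incident with an edge of [C]. *)
Definition circuit C : bool :=
  [&& C != set0,
      [forall v, (deg_in C v == 0%N) || (deg_in C v == 2%N)] &
      [forall v, forall w, (0 < deg_in C v)%N ==> (0 < deg_in C w)%N ==>
         connect (adj_in C) v w]].

Definition is_sign (s : int) : bool := (s == 1) || (s == -1).

Definition signature (sigma : edge G -> int) : Prop :=
  forall e, is_sign (sigma e).

Section Signed.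
Variable sigma : edge G -> int.

Definition neg_edges : {set edge G} := [set e | sigma e == -1].

Definition unbalanced C : bool := odd #|C :&: neg_edges|.

(* If [F] is a 2-factor, the circuits included in [F] are its components. *)
Definition num_unbalanced_circuits F : nat :=
  #|[set C : {set edge G} | [&& C \subset F, circuit C & unbalanced C]]|.

Definition orientation (tau : half -> int) : Prop :=
  (forall h, is_sign (tau h)) /\
  (forall e, tau (e, false) * tau (e, true) = - sigma e).

Definition flow (k : nat) (tau : half -> int) (f : edge G -> int) : Prop :=
  [/\ orientation tau,
      forall e, `|f e| <= k%:Z - 1 &
      forall v, \sum_(h in half_at v) tau h * f h.1 = 0].

Definition has_nowhere_zero_flow (k : nat) : Prop :=
  exists tau f, flow k tau f /\ forall e, f e != 0.

Definition flow_admissible : Prop :=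
  exists2 k : nat, (2 <= k)%N & has_nowhere_zero_flow k.

End Signed.
End Graphs.

(* Main.v *)
(* A cubic graph with a proper edge coloring by R, B, Y amounts to three
   fixed-point-free involutions of its vertex set.

   If two colors, such as R and B, form an even 2-factor, its unbalanced circuits
   can be joined in pairs along a forest of edges of the third color; this gives
   a flow with values 1 on R and B and 0 or 2 on Y (up to sign).  When Y has the
   parity of R and B, such flows f for RB and g for RY make f + 3g an 8-flow.
   When it has not, but RB contains an unbalanced circuit, exchanging R and B on
   that circuit restores equal parities.

   Otherwise all circuits of RB are balanced, so RB carries a flow f with values
   +-1, and RY has an odd number of unbalanced circuits.  If there are at least
   three of them, one of them gets the values +-2 and is joined by an edge of
   value +-4 to a pairing of the others; this yields g with values 1 to 3 on R
   and Y and at most 4 on B, and 5f + g is a 10-flow.  If there is only one, C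
   (or, exchanging R and B, only one in BY), let g be a +-1 flow on the other
   circuits of RY.  A flow-admissible unbalanced graph stays unbalanced after
   deleting any one edge; hence there is a flow h with values 1 to 3 on C, at most
   1 on the rest of RY, and at most 3 on B, obtained from C and an unbalanced
   circuit disjoint from C joined by a path, or from balanced circuits whose arcs
   on C cover C.  Then 4f + 2g + h is an 8-flow. *)

(* Flow values are functions on the vertices, one per color, invariant under the matching of that
   color; partial flows on disjoint vertex sets are then glued by addition. The sign of a circuit of
   an even 2-factor is the product of the orientations of its half edges: each edge contributes
   $-\sigma(e)$, and the number of edges is even.

   The obstacle is a circuit that is the only unbalanced one: it cannot be paired, and admissibility
   has to produce its values. The number 4 governs that case. A balanced circuit meets consistent
   demands of total size at most 4 with values of size at most 1, because these values are partial
   sums, free up to a constant, and spread over at most half the total; a link between circuits then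
   carries at most 2. A chord of weight 1 demands 2 from its component, so every component may be
   given chords of total weight 2.

   The multipliers keep sums away from 0: in 4f + 2g + h, wherever f is +-1 the value 4 exceeds what
   2g + h reaches (3 on the circuit and on B, 2 + 1 elsewhere), and where f is 0 and g is +-1, 2
   exceeds 1. In 5f + g, the 5 exceeds the bound 4 on g. *)
Require Import Defs.
From HB Require Import structures.
From mathcomp Require Import all_boot all_order all_algebra.
From mathcomp Require Import zify ring.

Set Implicit Arguments.
Unset Strict Implicit.
Unset Printing Implicit Defensive.
Import Order.TTheory GRing.Theory Num.Theory.
Local Open Scope ring_scope.

(** * Covering an unbalanced circuit by arcs *)

(* The circuit has vertices 0, ..., n-1 and is switched so that only the edge
   from n-1 to 0 is negative.  Removing its edges leaves balanced components; cl k
   is the component containing vertex k, and s k its sign there relative to the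
   circuit.  A profile Z gives the flow values Z k on the edge from k to k+1. *)
Section ChordCover.
Variables (n : nat) (T : eqType) (cl : nat -> T) (s : nat -> int).
Hypothesis n_gt0 : (0 < n)%N.
Hypothesis s_sign : forall k, s k = 1 \/ s k = -1.

Definition chord : finType := (('I_n * 'I_n)%type : finType).
Implicit Types (P : chord) (A : {set chord}).

Definition valid P := (P.1 < P.2)%N && (cl P.1 == cl P.2).
Definition same P := s P.1 == s P.2.

(** The balanced circuit through [P] uses the arc between its ends if the signs agree and the
    complementary arc otherwise. The latter is cut at the negative edge into the part from [P.2] on
    ([covers]) and the part below [P.1] ([before]). *)
Definition lft P : nat := if same P then (P.1 : nat) else P.2.
Definition rgt P : nat := if same P then (P.2 : nat) else n.
Definition covers k P := (lft P <= k < rgt P)%N.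
Definition before k P := ~~ same P && (k < P.1)%N.

(* The flow on the circuit produced by one unit sent through a component between
   the ends of P: if the signs of the ends differ, the balanced circuit used
   contains the negative edge, hence the change of sign. *)
Definition wave P k : int := (covers k P)%:R - (before k P)%:R.

(* The amount leaving the circuit at vertex k under the profile Z. *)
Definition drops (Z : nat -> int) k : int :=
  if k == 0%N then - Z 0%N - Z n.-1 else Z k.-1 - Z k.

Lemma drop_wave P k : valid P -> (k < n)%N ->
  drops (wave P) k =
    (if same P then 1 else -1) * (k == P.2)%:R - (k == P.1)%:R.
Proof.
rewrite /drops /wave /covers /before /lft /rgt => /andP[lt12 _] ltkn.
have lt1n := ltn_ord P.1; have lt2n := ltn_ord P.2.
move: (same P) lt12 lt1n lt2n; move: (nat_of_ord P.1) (nat_of_ord P.2) => i j b.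
by case: b => /=; case: (altP (k =P 0%N)) => [->|]; lia.
Qed.

Lemma drop_sum A (w : chord -> int) k :
  drops (fun k => \sum_(P in A) w P * wave P k) k =
  \sum_(P in A) w P * drops (wave P) k.
Proof.
rewrite /drops; case: (k == 0%N).
  rewrite -!sumrN -big_split; apply: eq_bigr => P _ /=.
  by ring.
by rewrite -sumrB; apply: eq_bigr => P _; ring.
Qed.

Lemma wave_class P q : valid P ->
  \sum_(k < n | cl k == q) s k * drops (wave P) k = 0 /\
  \sum_(k < n | cl k == q) `|drops (wave P) k| <= 2 * (cl P.1 == q)%:R.
Proof.
move=> vP; have /andP[lt12 /eqP cl12] := vP.
have [clq|clq] := eqVneq (cl P.1) q; last first.
  have E : forall k : 'I_n, cl k == q -> drops (wave P) k = 0.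
    move=> k /eqP ck; rewrite drop_wave //.
    have -> : (k == P.2 :> nat) = false.
      by apply/negP => /eqP e; move: clq; rewrite cl12 -e ck eqxx.
    have -> : (k == P.1 :> nat) = false.
      by apply/negP => /eqP e; move: clq; rewrite -e ck eqxx.
    by rewrite mulr0 subr0.
  rewrite mulr0 !big1 // => k ck; first by rewrite E ?normr0.
  by rewrite E ?mulr0.
have ne12 : P.2 != P.1 by apply: contraTneq lt12 => ->; rewrite ltnn.
have c1 : cl P.1 == q by apply/eqP.
have c2 : cl P.2 == q by rewrite -cl12.
rewrite mulr1.
have E : forall k : 'I_n, (cl k == q) && (k != P.1) && (k != P.2) ->
    drops (wave P) k = 0.
  move=> k /andP[/andP[_ k1] k2]; rewrite drop_wave //.
  have -> : (k == P.2 :> nat) = false by rewrite -val_eqE in k2; apply/negbTE.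
  have -> : (k == P.1 :> nat) = false by rewrite -val_eqE in k1; apply/negbTE.
  by rewrite mulr0 subr0.
have E1 : (P.1 == P.2 :> nat) = false by rewrite eq_sym; apply: negbTE.
have E2 : (P.2 == P.1 :> nat) = false by apply: negbTE.
split.
  rewrite (bigD1 P.1) //= (bigD1 P.2) /=; last by rewrite c2.
  rewrite big1 => [|k hk]; last by rewrite E ?mulr0.
  rewrite !drop_wave // !eqxx E1 E2 /same.
  case: eqP => [->|]; first by ring.
  by case: (s_sign P.1) => ->; case: (s_sign P.2) => ->.
rewrite (bigD1 P.1) //= (bigD1 P.2) /=; last by rewrite c2.
rewrite big1 => [|k hk]; last by rewrite E ?normr0.
by rewrite !drop_wave // !eqxx E1 E2; case: (same P).
Qed.

(** The signed sum must vanish for a balanced component to pass on what it receives; 4 is the total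
    that it can route with values at most 1 on its own circuits, as in [orb_demand]. *)
Definition balanced_profile (Z : nat -> int) := forall q,
  \sum_(k < n | cl k == q) s k * drops Z k = 0 /\
  \sum_(k < n | cl k == q) `|drops Z k| <= 4.

Lemma profile_sum A (w : chord -> int) :
  (forall P, P \in A -> valid P) ->
  (forall q, \sum_(P in A | cl P.1 == q) `|w P| <= 2) ->
  balanced_profile (fun k => \sum_(P in A) w P * wave P k).
Proof.
move=> vA wA q; split.
  under eq_bigr => k _ do rewrite drop_sum mulr_sumr.
  rewrite exchange_big /= big1 // => P PA.
  under eq_bigr => k _ do rewrite mulrCA.
  by rewrite -mulr_sumr (wave_class q (vA _ PA)).1 mulr0.
apply: (@le_trans _ _ (\sum_(P in A) `|w P| * (2 * (cl P.1 == q)%:R))).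
  apply: (@le_trans _ _ (\sum_(k < n | cl k == q)
                           \sum_(P in A) `|w P| * `|drops (wave P) k|)).
    apply: ler_sum => k _; rewrite drop_sum.
    apply: le_trans (ler_norm_sum _ _ _) _.
    by apply: ler_sum => P _; rewrite normrM.
  rewrite exchange_big /=; apply: ler_sum => P PA.
  by rewrite -mulr_sumr ler_wpM2l // (wave_class q (vA _ PA)).2.
have -> : \sum_(P in A) `|w P| * (2 * (cl P.1 == q)%:R) =
          2 * \sum_(P in A | cl P.1 == q) `|w P|.
  rewrite mulr_sumr big_mkcondr /=; apply: eq_bigr => P _.
  by case: ifP => _; rewrite ?mulr1 ?mulr0 ?mulr1 // mulrC.
by have := wA q; lia.
Qed.

(** Every edge of the circuit lies in the support of some wave. [chord_flow] derives this from a
    nowhere-zero flow. *)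
Hypothesis admissible : forall m, (m < n)%N -> exists P,
  valid P && (if same P then (P.1 <= m < P.2)%N else ~~ (P.1 <= m < P.2)%N).

(** The two waves add up to -2, -1, 1, 2 on the arcs starting at 0, [i], [j], [k]: each wave
    vanishes only between the ends of its own chord, where the other one does not. *)
Lemma alternating_profile (i j k : 'I_n) :
  (i < j)%N -> (j < k)%N -> cl i = cl j -> cl j = cl k ->
  s i != s j -> s j != s k ->
  exists Z, (forall m, (m < n)%N -> 1 <= `|Z m| <= 3) /\ balanced_profile Z.
Proof.
move=> ij jk cij cjk sij sjk.
pose A : {set chord} := [set (i, j); (j, k)].
have neq : (i, j) \notin [set (j, k)].
  by rewrite inE xpair_eqE negb_and -!val_eqE /=; apply/orP; left; lia.
exists (fun m => \sum_(P in A) 1 * wave P m); split.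
  move=> m mn; rewrite big_setU1 //= big_set1 /wave /covers /before /lft /rgt.
  rewrite /same /= (negbTE sij) (negbTE sjk) /=.
  by have := ltn_ord k; lia.
apply: (profile_sum (w := fun=> 1)) => [P|q].
  by rewrite !inE /valid => /orP[] /eqP -> /=; rewrite ?ij ?jk ?cij ?cjk eqxx.
rewrite big_mkcondr /= big_setU1 //= big_set1.
by case: ifP; case: ifP.
Qed.

(* Among the chords with differing signs, Q has the largest Q.1 and then the least
   Q.2.  It gets weight -2, and a minimal family of chords covering the gap
   [Q.1, Q.2) gets weight 1.  By minimality at most two of them overlap, at
   most one reaches beyond either end of the gap, and distinct chords lie in
   distinct components. *)
Lemma nonalternating_profile :
  (forall i j k : 'I_n, (i < j)%N -> (j < k)%N -> cl i = cl j -> cl j = cl k ->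
     s i != s j -> s j = s k) ->
  exists Z, (forall m, (m < n)%N -> 1 <= `|Z m| <= 3) /\ balanced_profile Z.
Proof.
move=> noalt.
(* No chord with equal signs reaches the edge leaving [n.-1], so the chord provided for that edge
   has differing signs. *)
have [P0 vP0 dP0] : exists2 P, valid P & ~~ same P.
  have /admissible[P /andP[vP]] : (n.-1 < n)%N by rewrite prednK.
  case: ifP => [_|sP _]; last by exists P; rewrite ?sP.
  by move: (nat_of_ord P.1) (nat_of_ord P.2) (ltn_ord P.2) => i j; lia.
have [Q [vQ dQ Qmax Qmin]] : exists Q, [/\ valid Q, ~~ same Q,
    forall P, valid P -> ~~ same P -> (P.1 <= Q.1)%N &
    forall P, valid P -> ~~ same P -> P.1 = Q.1 -> (Q.2 <= P.2)%N].
  have D0 : valid P0 && ~~ same P0 by rewrite vP0.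
  case: (arg_maxnP (P := fun P => valid P && ~~ same P) (fun P : chord => P.1 : nat) D0).
  move=> Q1 /= D1 max1.
  have D1' : valid Q1 && ~~ same Q1 && (Q1.1 == Q1.1) by rewrite D1 eqxx.
  case: (arg_minnP (P := fun P => valid P && ~~ same P && (P.1 == Q1.1))
           (fun P : chord => P.2 : nat) D1').
  move=> Q /= /andP[/andP[vQ dQ] /eqP e1] min1.
  exists Q; split=> // P vP dP; first by rewrite e1; apply: max1; rewrite vP.
  by move=> e; apply: min1; rewrite vP dP e e1 eqxx.
pose mid m := (Q.1 <= m < Q.2)%N.
have midn m : mid m -> (m < n)%N.
  by case/andP=> _ h; apply: ltn_trans h (ltn_ord _).
pose covering (A : {set chord}) := [forall P in A, valid P] &&
  [forall m : 'I_n, mid m ==> [exists P in A, covers m P]].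
have [F covF Fmin] :
    exists2 F, covering F & forall A, covering A -> (#|F| <= #|A|)%N.
  have covA : covering [set P | valid P].
    apply/andP; split; first by apply/forall_inP => P; rewrite inE.
    apply/forallP => m; apply/implyP => /andP[Q1m mQ2].
    have [P /andP[vP hP]] := admissible (ltn_ord m).
    apply/exists_inP; exists P; rewrite ?inE //.
    (* A chord with differing signs could also reach [m] through its part below [P.1], but [P.1] is
       at most [Q.1], hence at most [m]. *)
    rewrite /covers /lft /rgt; case: ifP hP => // sP.
    rewrite negb_and -ltnNge -leqNgt => /orP[mP1|->]; last exact: ltn_ord.
    by have := Qmax P vP (negbT sP); rewrite leqNgt (leq_ltn_trans Q1m mP1).
  case: (arg_minnP (fun A : {set chord} => #|A|) covA) => F covF Fmin.
  by exists F.
have vF P : P \in F -> valid P.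
  by move=> PF; have /andP[/forall_inP h _] := covF; exact: h.
have cF m : mid m -> exists2 P, P \in F & covers m P.
  move=> mm; have /andP[_ /forallP h] := covF.
  have /implyP/(_ mm)/exists_inP[P PF cP] := h (Ordinal (midn m mm)).
  by exists P.
(* A chord without a point of the gap covered by it alone could be dropped from the minimal
   family. *)
have private P : P \in F -> exists2 m, mid m &
    covers m P /\ forall P', P' \in F -> P' != P -> ~~ covers m P'.
  move=> PF; pose priv (m : 'I_n) := [&& mid m, covers m P &
    [forall P' in F, (P' != P) ==> ~~ covers m P']].
  have [/existsP[m /and3P[mm cm /forall_inP h]]|] := boolP [exists m, priv m].
    by exists m => //; split=> // P' P'F; apply/implyP/h.
  move/existsPn => nopriv; suff : covering (F :\ P).
    by move/Fmin; rewrite (cardsD1 P F) PF add1n ltnn.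
  apply/andP; split; first by apply/forall_inP => R /setD1P[_ /vF].
  apply/forallP => m; apply/implyP => mm.
  have [R RF cR] := cF m mm; have [eRP|neRP] := eqVneq R P; last first.
    by apply/exists_inP; exists R; rewrite // !inE neRP.
  have := nopriv m; rewrite /priv mm -eRP cR /= negb_forall.
  case/existsP => R'; rewrite !negb_imply => /and3P[R'F nR' /negPn cR'].  
apply/exists_inP; exists R'; rewrite ?inE ?nR' //.
  by move: cR'; rewrite !negbK andbT.
have replace P P' R : P \in F -> P' \in F -> P != P' -> valid R ->
    (forall m, mid m -> covers m P || covers m P' -> covers m R) -> False.
  move=> PF P'F neP vR cR; suff : covering (R |: (F :\ P) :\ P').
    move/Fmin; rewrite (cardsD1 P F) PF (cardsD1 P' (F :\ P)) !inE eq_sym neP P'F.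
    rewrite cardsU1 !add1n => h; have := leq_trans h (leq_add (leq_b1 _) (leqnn _)).
    by rewrite add1n ltnn.
  apply/andP; split.
    by apply/forall_inP => S; rewrite !inE => /orP[/eqP-> //|/and3P[_ _ /vF]].
  apply/forallP => m; apply/implyP => mm; apply/exists_inP.
  have [S SF cS] := cF m mm.
  have [cPP'|] := boolP (covers m P || covers m P').
    by exists R; [rewrite !inE eqxx|exact: cR].
  rewrite negb_or => /andP[nP nP']; exists S => //; rewrite !inE SF andbT.
  have -> : S != P by apply: contraNneq nP => <-.
  by rewrite (_ : S != P') ?orbT //; apply: contraNneq nP' => <-.
have sep P P' : P \in F -> P' \in F -> P != P' -> exists x x', [/\
    mid x && mid x', covers x P, covers x' P', ~~ covers x P' & ~~ covers x' P].
  move=> PF P'F neP; have [x mx [cx nx]] := private P PF.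
  have [x' mx' [cx' nx']] := private P' P'F.
  exists x, x'; rewrite mx mx'; split=> //; first by apply: nx; rewrite // eq_sym.
  exact: nx'.
(* Both arcs enter the gap from the same side, so the one reaching farther contains the private
   point of the other. *)
have once m P P' : P \in F -> P' \in F -> covers m P -> covers m P' ->
    ~~ mid m -> P = P'.
  move=> PF P'F; have [//|neP] := eqVneq P P'.
  have [x [x' []]] := sep P P' PF P'F neP.
  rewrite /mid /covers; move: (nat_of_ord Q.1) (nat_of_ord Q.2) => q1 q2.
  by move: (lft P) (rgt P) (lft P') (rgt P') => l r l' r'; clear; lia.
(* Of three intervals through a common point, one lies in the union of the other two and so has no
   private point. *)
have twice m P P' P'' : P \in F -> P' \in F -> P'' \in F ->
    covers m P -> covers m P' -> covers m P'' ->
    [|| P == P', P' == P'' | P'' == P].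
  move=> PF P'F P''F cP cP' cP''; apply/negPn/negP; rewrite !negb_or.
  case/and3P => n1 n2 n3.
  have [x _ [cx nx]] := private P PF.
  have [x' _ [cx' nx']] := private P' P'F.
  have [x'' _ [cx'' nx'']] := private P'' P''F.
  have := nx P' P'F; have := nx P'' P''F n3; rewrite eq_sym n1 => h1 /(_ isT) h2.
  have := nx' P'' P''F; have := nx' P PF n1; rewrite eq_sym n2 => h3 /(_ isT) h4.
  have := nx'' P PF; have := nx'' P' P'F n2; rewrite eq_sym n3 => h5 /(_ isT) h6.
  move: cP cP' cP'' cx cx' cx'' h1 h2 h3 h4 h5 h6 {nx nx' nx''}.
  rewrite /covers; move: (lft P) (rgt P) (lft P') (rgt P') => l r l' r'.
  by move: (lft P'') (rgt P''); clear; lia.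
(* The arcs of chords with differing signs all end at [n], hence are nested. *)
have crossing1 P P' : P \in F -> P' \in F -> ~~ same P -> ~~ same P' -> P = P'.
  move=> PF P'F sP sP'; have [//|neP] := eqVneq P P'.
  have [x [x' []]] := sep P P' PF P'F neP.
  rewrite /mid /covers /rgt (negbTE sP) (negbTE sP').
  move: (ltn_ord Q.2); move: (nat_of_ord Q.1) (nat_of_ord Q.2) => q1 q2.
  by move: (lft P) (lft P') => l l'; clear; lia.
have neq_eq i j k : s i != s j -> s j != s k -> s i = s k.
  by case: (s_sign i) => ->; case: (s_sign j) => ->; case: (s_sign k) => ->.
have alt i j k : (i < j)%N -> (j < k)%N -> cl i = cl j -> cl j = cl k ->
    (k < n)%N -> s i != s j -> s j != s k -> False.
  move=> ij jk cij cjk kn sij /eqP; apply; have jn := ltn_trans jk kn.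
  exact: (noalt (Ordinal (ltn_trans ij jn)) (Ordinal jn) (Ordinal kn)).
have diff i j : (i < j)%N -> (j < n)%N -> cl i = cl j -> s i != s j ->
    (i <= Q.1)%N /\ (i = Q.1 -> (Q.2 <= j)%N).
  move=> ij jn cij sij; pose P := (Ordinal (ltn_trans ij jn), Ordinal jn) : chord.
  have vP : valid P by rewrite /valid /= ij cij eqxx.
  have dP : ~~ same P by [].
  split; first exact: (Qmax P vP dP).
  by move=> e; apply: (Qmin P vP dP); apply: val_inj.
have ltneq i j : s i != s j -> (i < j)%N \/ (j < i)%N.
  by move=> sij; case: (ltngtP i j) => [||e]; [left|right|move: sij; rewrite e eqxx].
have notin P x : mid x -> covers x P -> same P -> (Q.1 < P.2)%N.
  rewrite /mid /covers /rgt => /andP[h _] + sP.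
  by rewrite sP => /andP[_]; apply: leq_ltn_trans.
have nosplit P P' : P \in F -> P' \in F -> cl P.1 = cl P'.1 -> same P -> same P' ->
    s P.1 != s P'.1 -> (P.1 < P'.1)%N -> False.
  move=> PF P'F cPP' sP sP' sPP' lt1; have [x mx [cx _]] := private P PF.
  have Q1P2 := notin P x mx cx sP; have /andP[ltP /eqP cP] := vF P PF.
  have s2 : s P.2 != s P'.1 by rewrite -(eqP sP).
  have [h|h] := ltneq _ _ s2.
    have [||le1 _] := diff P.2 P'.1 h (ltn_ord _) => //; first by rewrite -cP.
    by move: Q1P2; rewrite ltnNge le1.
  by apply: (alt P.1 P'.1 P.2) => //; [rewrite -cPP'|rewrite eq_sym].
have twosame P P' : P \in F -> P' \in F -> cl P.1 = cl P'.1 -> same P -> same P' ->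
    P = P'.
  move=> PF P'F cPP' sP sP'; have [//|neP] := eqVneq P P'.
  have [sPP'|sPP'] := eqVneq (s P.1) (s P'.1); last first.
    have [h|h] := ltneq _ _ sPP'; first by case: (nosplit P P').
    by case: (nosplit P' P) => //; rewrite eq_sym.
  have /andP[ltP /eqP cP] := vF P PF; have /andP[ltP' /eqP cP'] := vF P' P'F.
  (* The hull of the two chords could replace both, against minimality. *)
  pose R := (if (P.1 <= P'.1)%N then P.1 else P'.1,
             if (P.2 <= P'.2)%N then P'.2 else P.2) : chord.
  have sR : same R.
    rewrite /same /R /=; case: leqP => _; case: leqP => _ //.
    - by rewrite sPP'.
    - by rewrite -sPP'.
  case: (replace P P' R) => //.
    rewrite /valid /R /=; case: (leqP P.1 P'.1) => h1; case: (leqP P.2 P'.2) => h2 /=.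
    - by rewrite (leq_ltn_trans h1 ltP') cPP' cP' eqxx.
    - by rewrite ltP cP eqxx.
    - by rewrite ltP' cP' eqxx.
    - by rewrite (ltn_trans h1 ltP) -cPP' cP eqxx.
  move=> m _; rewrite /covers /lft /rgt sP sP' sR /R /=.
  case: (leqP P.1 P'.1); case: (leqP P.2 P'.2);
  move: (nat_of_ord P.1) (nat_of_ord P.2) (nat_of_ord P'.1) (nat_of_ord P'.2);
  by move=> i j i' j' le1 le2 /orP[] /andP[h1 h2]; clear -le1 le2 h1 h2; lia.
have samediff P P' : P \in F -> P' \in F -> cl P.1 = cl P'.1 -> same P ->
    ~~ same P' -> False.
  move=> PF P'F cPP' sP sP'; have [x mx [cx _]] := private P PF.
  have Q1P2 := notin P x mx cx sP.
  have /andP[ltP /eqP cP] := vF P PF; have /andP[ltP' /eqP cP'] := vF P' P'F.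
  have [sPP'|sPP'] := eqVneq (s P.1) (s P'.1).
    have s2 : s P'.2 != s P.2 by rewrite -(eqP sP) sPP' eq_sym.
    have [h|h] := ltneq _ _ s2.
      by apply: (alt P'.1 P'.2 P.2) => //; rewrite -cP' -cPP'.
    have [||le1 _] := diff P.2 P'.2 h (ltn_ord _).
    - by rewrite -cP cPP'.
    - by rewrite eq_sym.
    - by move: Q1P2; rewrite ltnNge le1.
  have [h|h] := ltneq _ _ sPP'; first by apply: (alt P.1 P'.1 P'.2).
  (* This chord has differing signs, and its arc runs from the earlier of [P.1] and [P'.2] up to
     [n], so it could replace both. *)
  pose R := (P'.1, if (P.1 <= P'.2)%N then P.1 else P'.2) : chord.
  have s2 : s P'.1 != s P.1 by rewrite eq_sym.
  have dR : ~~ same R by rewrite /same /R /=; case: leqP.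
  apply: (replace P P' R) => //; first by apply: contraNneq sP' => <-.
    by rewrite /valid /R /=; case: (leqP P.1 P'.2); rewrite ?h ?ltP' ?cPP' -?cP' ?eqxx.
  move=> m _; rewrite /covers /lft /rgt sP (negbTE sP') (negbTE dR) /R /=.
  move: (ltn_ord P.2); case: (leqP P.1 P'.2);
  move: (nat_of_ord P.1) (nat_of_ord P.2) (nat_of_ord P'.2);
  by move=> i j j' le1 jn /orP[] /andP[h1 h2]; clear -le1 jn h1 h2; lia.
have twocls P P' : P \in F -> P' \in F -> cl P.1 = cl P'.1 -> P = P'.
  move=> PF P'F cPP'; have [sP|sP] := boolP (same P); have [sP'|sP'] := boolP (same P').
  - exact: twosame.
  - by case: (samediff P P').
  - by case: (samediff P' P).
  - exact: crossing1.
(* The weight -2 of [Q] already exhausts the allowance of its component. *)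
have newcls P : P \in F -> cl P.1 != cl Q.1.
  move=> PF; apply/eqP => cPQ; have [x mx [cx _]] := private P PF.
  have /andP[ltP /eqP cP] := vF P PF; have /andP[ltQ /eqP cQ] := vQ.
  have /andP[Q1x xQ2] := mx.
  have [sP|sP] := boolP (same P).
    have Q1P2 := notin P x mx cx sP; move: cx; rewrite /covers /lft /rgt sP.
    case/andP => P1x xP2.
    have [sPQ|sPQ] := eqVneq (s P.1) (s Q.1).
      have s2 : s Q.2 != s P.2 by rewrite -(eqP sP) sPQ eq_sym.
      have [h|h] := ltneq _ _ s2.
        by apply: (alt Q.1 Q.2 P.2) => //; rewrite -cQ -cPQ cP.
      have [] := diff P.2 Q.2 h (ltn_ord _); first by rewrite -cQ -cPQ cP.
        by rewrite eq_sym.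
      by rewrite leqNgt Q1P2.
    have [h|h] := ltneq _ _ sPQ.
      by apply: (alt P.1 Q.1 Q.2).
    have [//||_ /(_ erefl)] := diff Q.1 P.1 h (ltn_ord _).
      by rewrite eq_sym.
    by rewrite leqNgt (leq_ltn_trans P1x xQ2).
  move: cx; rewrite /covers /lft (negbTE sP) => /andP[P2x _].
  have [sPQ|sPQ] := eqVneq (s P.2) (s Q.1).
    have [le1 _] := diff P.1 P.2 ltP (ltn_ord _) cP sP.
    have sP1 : s P.1 != s Q.1 by rewrite -sPQ.
    have [h|h] := ltneq _ _ sP1; last by move: h; rewrite ltnNge le1.
    exact: (alt P.1 Q.1 Q.2).
  have [h|h] := ltneq _ _ sPQ.
    by apply: (alt P.2 Q.1 Q.2) => //; rewrite -cP.
  have [||_ /(_ erefl)] := diff Q.1 P.2 h (ltn_ord _).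
  - by rewrite -cP.
  - by rewrite eq_sym.
  - by rewrite leqNgt (leq_ltn_trans P2x xQ2).
have QnF : Q \notin F by apply/negP => /newcls; rewrite eqxx.
pose w P : int := if P == Q then -2 else 1.
have wF P : P \in F -> w P = 1.
  by rewrite /w; case: eqP => // -> QF; rewrite QF in QnF.
exists (fun k => \sum_(P in Q |: F) w P * wave P k); split; last first.
  apply: profile_sum => [P|q].
    by rewrite !inE => /orP[/eqP->|/vF].
  have wF1 : \sum_(P in F | cl P.1 == q) `|w P| = #|[set P in F | cl P.1 == q]|%:R.
    rewrite -sum1_card natr_sum; apply: eq_big => [P|P /andP[PF _]].
      by rewrite inE.
    by rewrite wF.
  rewrite big_mkcondr /= big_setU1 //= -big_mkcondr wF1.
  have [clq|clq] := eqVneq (cl Q.1) q.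
    rewrite /w eqxx (_ : [set P in F | cl P.1 == q] = set0) ?cards0 //.
    apply/setP => P; rewrite !inE -clq; apply/negbTE; rewrite negb_and.
    by have [/newcls|] := boolP (P \in F).
  rewrite add0r (ler_nat _ _ 2) leqW //; apply/card_le1_eqP => P P'.
  rewrite !inE => /andP[PF /eqP cP] /andP[P'F /eqP cP'].
  by apply: twocls; rewrite // cP.
(* The value is 2 + a - b with a, b in {0, 1} below the gap, 1 or 2 inside it, and -2 or -1 beyond
   it. *)
move=> k kn; rewrite big_setU1 //= /w eqxx.
pose Ak := [set P in F | covers k P]; pose Bk := [set P in F | before k P].
have -> : \sum_(P in F) (if P == Q then -2 else 1) * wave P k =
          #|Ak|%:R - #|Bk|%:R :> int.
  transitivity (\sum_(P in F) ((covers k P)%:R - (before k P)%:R : int)).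
    by apply: eq_bigr => P /wF; rewrite /w => ->; rewrite mul1r.
  have count (b : pred chord) :
      \sum_(P in F) (b P)%:R = #|[set P in F | b P]|%:R :> int.
    rewrite -sum1_card natr_sum [RHS]big_mkcond [LHS]big_mkcond /=.
    by apply: eq_bigr => P _; rewrite inE; case: (P \in F); case: (b P).
  by rewrite sumrB !count.
have A2 : (#|Ak| <= 2)%N.
  rewrite leqNgt; apply/card_gt2P => -[P [P' [P'' []]]].
  rewrite !inE => -[/andP[PF cP] /andP[P'F cP'] /andP[P''F cP'']] [n1 n2 n3].
  have := twice k P P' P'' PF P'F P''F cP cP' cP''.
  by rewrite (negbTE n1) (negbTE n2) (negbTE n3).
have A1 : ~~ mid k -> (#|Ak| <= 1)%N.
  move=> nmk; apply/card_le1_eqP => P P'.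
  by rewrite !inE => /andP[PF cP] /andP[P'F cP']; apply: (once k).
have B1 : (#|Bk| <= 1)%N.
  apply/card_le1_eqP => P P'; rewrite !inE => /andP[PF /andP[sP _]].
  by case/andP=> P'F /andP[sP' _]; apply: crossing1.
have B0 : (Q.1 <= k)%N -> #|Bk| = 0%N.
  move=> Qk; apply/eqP; rewrite cards_eq0; apply/eqP/setP => P; rewrite !inE.
  apply/negP => /andP[PF /andP[sP kP]].
  by have := Qmax P (vF P PF) sP; rewrite leqNgt (leq_ltn_trans Qk kP).
have Amid : mid k -> (0 < #|Ak|)%N.
  by move=> /cF[P PF cP]; apply/card_gt0P; exists P; rewrite inE PF.
move: A1 A2 B1 B0 Amid; rewrite /wave /covers /before /mid /lft /rgt (negbTE dQ) /=.
have /andP[ltQ _] := vQ; move: ltQ; move: (nat_of_ord Q.1) (nat_of_ord Q.2) => q1 q2.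
move: #|Ak| #|Bk| => x y ltQ A1 A2 B1 B0 Amid.
case: (ltnP k q1) => h1.
  have := A1 _; lia.
have := B0 h1; case: (ltnP k q2) => h2; lia.
Qed.

Lemma balanced_profile_exists :
  exists Z, (forall m, (m < n)%N -> 1 <= `|Z m| <= 3) /\ balanced_profile Z.
Proof.
have [/existsP[i /existsP[j /existsP[k]]]|noalt] := boolP [exists i : 'I_n,
    exists j : 'I_n, exists k : 'I_n, [&& (i < j)%N, (j < k)%N, cl i == cl j,
    cl j == cl k, s i != s j & s j != s k]].
  case/and5P => ij jk /eqP cij /eqP cjk /andP[sij sjk].
  exact: (@alternating_profile i j k).
apply: nonalternating_profile => i j k ij jk cij cjk sij.
apply/eqP; apply: contraNT noalt => sjk.
apply/existsP; exists i; apply/existsP; exists j; apply/existsP; exists k.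
by rewrite ij jk cij cjk sij sjk !eqxx.
Qed.

End ChordCover.

(** * Circuits formed by two perfect matchings *)

Definition sgn (x : int) := x = 1 \/ x = -1.

Lemma sgnM x y : sgn x -> sgn y -> sgn (x * y).
Proof. by rewrite /sgn => -[->|->] [->|->]; lia. Qed.

Lemma sgnN x : sgn x -> sgn (- x).
Proof. by rewrite /sgn; lia. Qed.

Lemma sgn_prod (I : finType) (P : pred I) (F : I -> int) :
  (forall i, P i -> sgn (F i)) -> sgn (\prod_(i | P i) F i).
Proof. by move=> h; elim/big_rec: _ => [|i x Pi]; [left|apply/sgnM/h]. Qed.

Section Matching.
Variables (V : finType) (m : V -> V).

Definition matching := involutive m /\ forall v, m v != v.

Hypothesis mm : matching.

Lemma matching_ind (P : {set V} -> Prop) :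
  P set0 ->
  (forall (A : {set V}) v, v \notin A -> m v \notin A -> P A -> P (v |: (m v |: A))) ->
  forall A : {set V}, (forall v, v \in A -> m v \in A) -> P A.
Proof.
case: mm => mK mN P0 PU A; have [n] := ubnP #|A|; elim: n A => // n IH A.
move=> ltAn clA; have [->//|[v vA]] := set_0Vmem A.
pose A' := A :\ v :\ m v.
have -> : A = v |: (m v |: A').
  by rewrite setD1K ?setD1K // !inE mN clA.
apply: PU; rewrite ?inE ?eqxx ?andbF //=; apply: IH => [|w].
  move: ltAn; rewrite (cardsD1 v A) vA (cardsD1 (m v) (A :\ v)) !inE mN clA //=.
  by rewrite -/A'; lia.
rewrite !inE => /and3P[w2 w1 wA]; rewrite (clA w wA) andbT.
rewrite (inj_eq (inv_inj mK)) w1 /=.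
by apply: contraNneq w2 => <-; rewrite mK.
Qed.

Lemma matching_prod (A : {set V}) (F : V -> int) :
  (forall v, v \in A -> m v \in A) -> (forall v, F (m v) = F v) ->
  (forall v, v \in A -> sgn (F v)) -> \prod_(v in A) F v = 1.
Proof.
move=> clA Fm; move: A clA; apply: matching_ind => [_|A v vA mvA IH sF].
  by rewrite big_set0.
rewrite !big_setU1 ?inE ?negb_or ?(eq_sym v) ?mm.2 ?vA //= IH => [|w wA]; last first.
  by apply: sF; rewrite !inE wA !orbT.
by rewrite Fm mulr1; case: (sF v _) => [|->|->]; rewrite // !inE eqxx.
Qed.

Lemma matching_sum (A : {set V}) (F : V -> int) :
  (forall v, v \in A -> m v \in A) ->
  (forall v, v \in A -> F (m v) = - F v) -> \sum_(v in A) F v = 0.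
Proof.
move: A; apply: matching_ind => [_|A v vA mvA IH sF].
  by rewrite big_set0.
rewrite !big_setU1 ?inE ?negb_or ?(eq_sym v) ?mm.2 ?vA //= IH => [|w wA]; last first.
  by apply: sF; rewrite !inE wA !orbT.
by rewrite sF ?inE ?eqxx // addr0 subrr.
Qed.
End Matching.

Definition nxt n k := if k.+1 == n then 0%N else k.+1.
Definition prv n k := if k == 0%N then n.-1 else k.-1.

Lemma nxt_ltn n k : (k < n)%N -> (nxt n k < n)%N.
Proof. by rewrite /nxt; case: eqP; lia. Qed.

Lemma prvP n k : (k < n)%N -> ~~ odd n ->
  [/\ (prv n k < n)%N, odd (prv n k) = ~~ odd k & nxt n (prv n k) = k].
Proof.
case: n k => [|n] [|k] //= ltkn; rewrite /prv /nxt /= ?eqxx; first by split; lia.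
by rewrite eqSS ltn_eqF //; split; lia.
Qed.

Lemma nxtP n k : (k < n)%N -> ~~ odd n ->
  odd (nxt n k) = ~~ odd k /\ prv n (nxt n k) = k.
Proof.
by rewrite /prv /nxt; case: (altP (k.+1 =P n)) => [<-|ne] //= kn en; split; lia.
Qed.

(** * The alternating walk around a circuit *)

Section Circuits.
Variables (V : finType) (m1 m2 : V -> V).
Hypotheses (mm1 : matching m1) (mm2 : matching m2).

Definition alt_rel : rel V := fun u v => (v == m1 u) || (v == m2 u).

(** The vertex set of the circuit through [v] in the 2-factor formed by the two matchings; two
    parallel edges give an orbit of two vertices. *)
Definition orb v : {set V} := [set w | connect alt_rel v w].

Lemma alt_sym : connect_sym alt_rel.
Proof.
case: mm1 mm2 => K1 _ [K2 _]; apply: sym_connect_sym => u v; rewrite /alt_rel.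
by rewrite -(inj_eq (inv_inj K1)) -[X in _ || X](inj_eq (inv_inj K2)) K1 K2 !(eq_sym u).
Qed.

Lemma orb_refl v : v \in orb v. Proof. by rewrite inE. Qed.

Lemma orb_eq v w : w \in orb v -> orb w = orb v.
Proof.
rewrite inE => vw; apply/setP => x; rewrite !inE.
by rewrite !(alt_sym _ x); apply/idP/idP => h; apply: connect_trans h _; rewrite // alt_sym.
Qed.

Lemma orb_m1 v w : (m1 w \in orb v) = (w \in orb v).
Proof.
rewrite !inE; have e : connect alt_rel w (m1 w).
  by apply: connect1; rewrite /alt_rel eqxx.
by apply/idP/idP => h; apply: connect_trans h _; rewrite // alt_sym.
Qed.

Lemma orb_m2 v w : (m2 w \in orb v) = (w \in orb v).
Proof.
rewrite !inE; have e : connect alt_rel w (m2 w).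
  by apply: connect1; rewrite /alt_rel eqxx orbT.
by apply/idP/idP => h; apply: connect_trans h _; rewrite // alt_sym.
Qed.

Lemma orb_min v (A : {set V}) : v \in A ->
  (forall w, w \in A -> m1 w \in A /\ m2 w \in A) -> orb v \subset A.
Proof.
move=> vA clA; apply/subsetP => w; rewrite inE => /connectP[p].
elim: p v vA => [|x p IH] v vA /= => [_ -> //|/andP[vx px] e].
by apply: (IH x) => //; case/orP: vx => /eqP ->; have [] := clA v vA.
Qed.

Definition circuit_walk r n (w : nat -> V) :=
  [/\ (0 < n)%N && ~~ odd n, {in gtn n &, injective w},
      orb r = [set w k | k : 'I_n], w 0%N = r &
      forall k, (k < n)%N -> w (nxt n k) = (if odd k then m2 else m1) (w k)].

Definition two_step v := m2 (m1 v).
Local Notation f := two_step.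

(** Cancelling [m2] and [m1] turns f^(k+2) x = m1 x into f^k (f x) = m1 (f x), which descends to a
    fixed point of [m1] or [m2]. So [r] and [m1 r] lie on different cycles of [two_step], which is
    why circuits have even length. *)
Lemma iter_alt_neq k x : iter k f x != m1 x.
Proof.
case: mm1 mm2 => K1 N1 [K2 N2].
have [b] := ubnP k; elim: b k x => // b IH [|[|k]] x; rewrite ?ltnS => lekb.
- by rewrite eq_sym N1.
- by rewrite N2.
rewrite iterS iterSr {1}/f -(inj_eq (inv_inj K2)) K2 -(inj_eq (inv_inj K1)) K1.
by rewrite -[m2 _]/(f x); apply: IH; apply: leq_trans lekb.
Qed.

Fixpoint walk r k :=
  if k is k'.+1 then (if odd k' then m2 else m1) (walk r k') else r.

Lemma walk_double r k : walk r k.*2 = iter k f r.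
Proof. by elim: k => //= k IH; rewrite odd_double /= -IH. Qed.

Lemma walkE r k : walk r k = (if odd k then m1 else id) (iter k./2 f r).
Proof.
rewrite -{1}(odd_double_half k); case: (odd k); last exact: walk_double.
by rewrite add1n /= odd_double walk_double.
Qed.

(** The length is twice the order of [r] under [two_step]: even positions run through the cycle of
    [r], odd ones through its image under [m1]. *)
Lemma walk_circuit r : exists n, circuit_walk r n (walk r).
Proof.
have [[K1 N1] [K2 N2]] := (mm1, mm2).
have f_inj : injective f by apply: (inj_comp (inv_inj K2) (inv_inj K1)).
pose N := order f r; have N0 : (0 < N)%N by apply: order_gt0.
have wn : walk r N.*2 = r by rewrite walk_double iter_order.
have wnxt k : (k < N.*2)%N -> walk r (nxt N.*2 k) = (if odd k then m2 else m1) (walk r k).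
  by rewrite /nxt => ltk; case: eqP => // e; rewrite -[RHS]/(walk r k.+1) e wn.
have iter_inj a b : (a < N)%N -> (b < N)%N -> iter a f r = iter b f r -> a = b.
  by move=> aN bN e; rewrite -(findex_iter aN) e findex_iter.
have nomix a b : iter a f r != m1 (iter b f r).
  have [leba|/ltnW leab] := leqP b a.
    by rewrite -(subnK leba) iterD iter_alt_neq.
  rewrite -(inj_eq (inv_inj K1)) K1 -(subnK leab) iterD eq_sym.
  exact: iter_alt_neq.
exists N.*2; split=> //; rewrite ?odd_double ?double_gt0 ?N0 //.
  move=> a b; rewrite !inE => aN bN; rewrite !walkE.
  have ha : (a./2 < N)%N by rewrite -ltn_double; lia.
  have hb : (b./2 < N)%N by rewrite -ltn_double; lia.
  rewrite -{3}(odd_double_half a) -{3}(odd_double_half b).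
  case: (odd a); case: (odd b) => /= e.
  - by rewrite (iter_inj _ _ ha hb (inv_inj K1 e)).
  - by have := nomix b./2 a./2; rewrite e eqxx.
  - by have := nomix a./2 b./2; rewrite e eqxx.
  - by rewrite (iter_inj _ _ ha hb e).
apply/eqP; rewrite eqEsubset; apply/andP; split; last first.
  apply/subsetP => _ /imsetP[k _ ->]; elim: (k : nat) => [|j IH] /=.
    exact: orb_refl.
  by case: (odd j); rewrite ?orb_m1 ?orb_m2.
have in_im k : (k < N.*2)%N -> walk r k \in [set walk r k | k : 'I_(N.*2)].
  by move=> kN; apply/imsetP; exists (Ordinal kN).
apply: orb_min; first by apply: (in_im 0%N); rewrite double_gt0.
move=> _ /imsetP[k _ ->].
have nxt_lt := nxt_ltn (ltn_ord k).
have [prv_lt oddp nxtp] := prvP (ltn_ord k) (negbT (odd_double N)).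
have wk := wnxt _ (ltn_ord k); have wp := wnxt _ prv_lt.
rewrite nxtp oddp in wp; split.
  case: (boolP (odd k)) wk wp => ok wk wp; last by rewrite -wk in_im.
  by rewrite wp /= K1 in_im.
case: (boolP (odd k)) wk wp => ok wk wp; first by rewrite -wk in_im.
by rewrite wp /= K2 in_im.
Qed.
End Circuits.

(** * Switchings and flows on a single circuit *)

Section CircuitFlows.
Variables (V : finType) (m1 m2 : V -> V).
Hypotheses (mm1 : matching m1) (mm2 : matching m2).
Variables (o1 o2 : V -> int).
Hypotheses (os1 : forall v, sgn (o1 v)) (os2 : forall v, sgn (o2 v)).

Local Notation orb := (orb m1 m2).

Lemma circuit_index r n w : circuit_walk m1 m2 r n w ->
  exists idx : V -> nat, forall k, (k < n)%N -> idx (w k) = k.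
Proof.
move=> [_ winj _ _ _]; exists (fun v => index v (mkseq w n)) => k kn.
rewrite -{1}(nth_mkseq (w 0%N) w kn) index_uniq ?size_mkseq //.
exact/mkseq_uniqP.
Qed.

Lemma circuit_mem r n w v : circuit_walk m1 m2 r n w ->
  reflect (exists2 k, (k < n)%N & v = w k) (v \in orb r).
Proof.
move=> [_ _ -> _ _]; apply: (iffP imsetP) => [[k _ ->]|[k kn ->]].
  by exists k.
by exists (Ordinal kn).
Qed.

Lemma circuit_step r n w k : circuit_walk m1 m2 r n w -> (k < n)%N ->
  m1 (w k) = w (if odd k then prv n k else nxt n k) /\
  m2 (w k) = w (if odd k then nxt n k else prv n k).
Proof.
move=> [/andP[n0 evn] _ _ _ wn] kn; have [pk op np] := prvP kn evn.
have wk := wn k kn; have wp := wn _ pk; rewrite np op in wp.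
case: (boolP (odd k)) wk wp => ok wk wp; split=> //.
- by rewrite wp (proj1 mm1).
- by rewrite wp (proj1 mm2).
Qed.

(** [X k] is the value on the edge from position [k] to the next one, an [m1] edge for even [k] and
    an [m2] edge for odd [k]; at each vertex the two colors read off the values of the edges before
    and after it. *)
Lemma circuit_values r n w (X : nat -> int) : circuit_walk m1 m2 r n w ->
  exists F1 F2 : V -> int, [/\ forall v, F1 (m1 v) = F1 v,
    forall v, F2 (m2 v) = F2 v, forall v, v \notin orb r -> F1 v = 0 /\ F2 v = 0 &
    forall k, (k < n)%N -> F1 (w k) = X (if odd k then prv n k else k) /\
                           F2 (w k) = X (if odd k then k else prv n k)].
Proof.
move=> cw; have [idx idxw] := circuit_index cw.
have [/andP[n0 evn] _ _ _ _] := cw; have orbP v := circuit_mem v cw.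
pose ev k := if odd k then prv n k else k; pose od k := if odd k then k else prv n k.
exists (fun v => if v \in orb r then X (ev (idx v)) else 0).
exists (fun v => if v \in orb r then X (od (idx v)) else 0).
have onorb k : (k < n)%N -> w k \in orb r by move=> kn; apply/orbP; exists k.
have step k : (k < n)%N ->
  ev (idx (m1 (w k))) = ev k /\ od (idx (m2 (w k))) = od k.
  move=> kn; have [pk op np] := prvP kn evn; have [on pn] := nxtP kn evn.
  have [-> ->] := circuit_step cw kn; rewrite /ev /od.
  case: (boolP (odd k)) op on => ok op on;
    by rewrite !idxw ?nxt_ltn // op on /= ?pn ?ok.
split=> [v|v|v|k kn].
- rewrite orb_m1 //; case: ifP => // /orbP[k kn ->].
  by rewrite (step k kn).1 idxw.
- rewrite orb_m2 //; case: ifP => // /orbP[k kn ->].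
  by rewrite (step k kn).2 idxw.
- by move=> /negbTE ->.
- by rewrite onorb // idxw.
Qed.

(** Orientations at position [k] of the half edges leading forward ([outer]) and backward ([inner])
    along the walk. *)
Definition outer (w : nat -> V) k := if odd k then o2 (w k) else o1 (w k).
Definition inner (w : nat -> V) k := if odd k then o1 (w k) else o2 (w k).

Lemma outer_sgn w k : sgn (outer w k).
Proof. by rewrite /outer; case: ifP => _; [apply: os2|apply: os1]. Qed.

Lemma inner_sgn w k : sgn (inner w k).
Proof. by rewrite /inner; case: ifP => _; [apply: os1|apply: os2]. Qed.

Lemma circuit_big r n w (R : Type) (idx : R) (op : Monoid.com_law idx) (g : V -> R) :
  circuit_walk m1 m2 r n w ->
  \big[op/idx]_(v in orb r) g v = \big[op/idx]_(k < n) g (w k).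
Proof.
move=> [_ winj -> _ _]; rewrite big_imset //= => i j _ _ e.
by apply/val_inj/winj => //; rewrite inE ltn_ord.
Qed.

(** Switching by [p], defined by recursion along the walk, makes every edge positive except possibly
    the closing one, which then bears the sign of the whole circuit. *)
Lemma walk_potential r n w : circuit_walk m1 m2 r n w ->
  exists p : nat -> int, [/\ forall k, sgn (p k),
    forall k, p k * outer w k = - (p k.+1 * inner w k.+1) &
    p n.-1 * outer w n.-1 =
      - ((\prod_(v in orb r) (o1 v * o2 v)) * (p 0%N * inner w 0%N))].
Proof.
move=> cw; have [/andP[n0 evn] _ _ _ _] := cw.
pose p k := \prod_(i < k) (- (outer w i * inner w i.+1)).
have pS k : p k.+1 = - (p k * (outer w k * inner w k.+1)).
  by rewrite /p big_ord_recr /= mulrN.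
exists p; split=> [k|k|].
- apply: sgn_prod => i _; apply/sgnN/sgnM; [exact: outer_sgn|exact: inner_sgn].
- rewrite pS; case: (inner_sgn w k.+1) => ->; ring.
have -> : \prod_(v in orb r) (o1 v * o2 v) = \prod_(k < n) (outer w k * inner w k).
  rewrite (circuit_big _ _ cw); apply: eq_bigr => k _.
  by rewrite /outer /inner; case: odd; rewrite // mulrC.
have p0 : p 0%N = 1 by rewrite /p big_ord0.
have E k : p k * outer w k * inner w 0%N =
    (-1) ^+ k * \prod_(i < k.+1) (outer w i * inner w i).
  elim: k => [|k IH]; first by rewrite p0 big_ord_recr big_ord0 /= expr0 !mul1r.
  rewrite big_ord_recr /= exprS; move: IH; set K := \prod_(i < k.+1) _ => IH.
  rewrite [RHS](_ : _ = - ((-1) ^+ k * K) * (outer w k.+1 * inner w k.+1)); last by ring.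
  rewrite -IH pS; ring.
have en : odd n.-1 by lia.
have := E n.-1; rewrite prednK // -signr_odd en expr1 mulN1r p0 mul1r.
move: (\prod_(k < n) _) => K.
by case: (inner_sgn w 0%N) => ->; lia.
Qed.

(** Switching by [s] makes the two halves of each edge opposite, that is, the edge positive. *)
Definition potential (S : {set V}) (s : V -> int) :=
  forall v, v \in S -> s (m1 v) * o1 (m1 v) = - (s v * o1 v) /\
                       s (m2 v) * o2 (m2 v) = - (s v * o2 v).

Lemma orb_potential r : \prod_(v in orb r) (o1 v * o2 v) = 1 ->
  exists s, (forall v, sgn (s v)) /\ potential (orb r) s.
Proof.
move=> bal; have [n cw] := walk_circuit mm1 mm2 r; move: (walk _ _ _) cw => w cw.
have [/andP[n0 evn] _ _ _ _] := cw.
have [p [ps pS pn]] := walk_potential cw; have [idx idxw] := circuit_index cw.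
have pnxt k : (k < n)%N -> p (nxt n k) * inner w (nxt n k) = - (p k * outer w k).
  move=> kn; rewrite /nxt; case: eqP => [e|_]; last by rewrite pS opprK.
  have -> : k = n.-1 by lia.
  by rewrite pn bal mul1r opprK.
exists (p \o idx); split=> [v|v /(circuit_mem _ cw)[k kn ->]] /=; first exact: ps.
have [pk op np] := prvP kn evn; have [on _] := nxtP kn evn.
have := pnxt k kn; have := pnxt _ pk.
have [-> ->] := circuit_step cw kn; rewrite np /inner /outer.
by case: (boolP (odd k)) op on => ok op on;
  rewrite !idxw ?nxt_ltn // op on /= => -> ->; rewrite opprK.
Qed.

Lemma orb_side r : exists side : V -> bool,
  forall v, v \in orb r -> side (m1 v) = ~~ side v /\ side (m2 v) = ~~ side v.
Proof.
have [n cw] := walk_circuit mm1 mm2 r; move: (walk _ _ _) cw => w cw.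
have [/andP[n0 evn] _ _ _ _] := cw; have [idx idxw] := circuit_index cw.
exists (odd \o idx) => v /(circuit_mem _ cw)[k kn ->] /=.
have [pk op np] := prvP kn evn; have [on _] := nxtP kn evn.
by have [-> ->] := circuit_step cw kn; case: (boolP (odd k)) op on => ok op on;
  rewrite !idxw ?nxt_ltn // op on /= ?ok ?(negbTE ok).
Qed.

(** After switching, the values are partial sums of the demands up to a constant. Their spread is at
    most half the total demand, hence at most 2, and a shift brings them into [-1, 1]. *)
Lemma orb_demand r s d : (forall v, sgn (s v)) -> potential (orb r) s ->
  \sum_(v in orb r) s v * d v = 0 -> \sum_(v in orb r) `|d v| <= 4 ->
  exists F1 F2 : V -> int, [/\ forall v, F1 (m1 v) = F1 v,
    forall v, F2 (m2 v) = F2 v, forall v, v \notin orb r -> F1 v = 0 /\ F2 v = 0,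
    forall v, `|F1 v| <= 1 /\ `|F2 v| <= 1 &
    forall v, v \in orb r -> o1 v * F1 v + o2 v * F2 v + d v = 0].
Proof.
move=> ss pot sum0 sum4.
have [n cw] := walk_circuit mm1 mm2 r; move: (walk _ _ _) cw => w cw.
have [/andP[n0 evn] _ _ _ _] := cw.
rewrite (circuit_big _ _ cw) in sum0; rewrite (circuit_big _ _ cw) in sum4.
pose Z k := - \sum_(i < k.+1) s (w i) * d (w i).
have Zn : Z n.-1 = 0 by rewrite /Z prednK // sum0 oppr0.
have ZE k : (k < n)%N -> Z k = - \sum_(l < n) (l <= k)%N%:R * (s (w l) * d (w l)).
  move=> kn; rewrite /Z; congr (- _).
  rewrite (big_ord_widen n (fun l => s (w l) * d (w l)) kn) big_mkcond /=.
  by apply: eq_bigr => l _; rewrite ltnS; case: leq; rewrite ?mul1r ?mul0r.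
have Zrange i j : (i < n)%N -> (j < n)%N -> Z i - Z j <= 2.
  (* Adding [c] times the vanishing total turns the coefficients 0 and +-2 into +-1; this gains the
     factor 2. *)
  move=> iN jN; pose c : int := if (i <= j)%N then -1 else 1.
  suff h : 2 * (Z i - Z j) <= \sum_(l < n) `|d (w l)|.
    by have := le_trans h sum4; lia.
  have -> : 2 * (Z i - Z j) = \sum_(l < n)
      (2 * (l <= j)%N%:R - 2 * (l <= i)%N%:R + c) * (s (w l) * d (w l)).
    rewrite !ZE // opprK addrC -sumrB mulr_sumr.
    have c0 : \sum_(l < n) c * (s (w l) * d (w l)) = 0 by rewrite -mulr_sumr sum0 mulr0.
    rewrite -[LHS]addr0 -[X in _ + X]c0 -big_split /=.
    by apply: eq_bigr => l _; ring.
  apply: ler_sum => l _; rewrite /c.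
  by case: (ss (w l)) => ->; case: (leqP i j) => ij; case: (leqP l j) => lj;
    case: (leqP l i) => li; lia.
have [k0 k0n kmax] : exists2 k0, (k0 < n)%N & forall k, (k < n)%N -> Z k <= Z k0.
  have [k0 _ kmax] := @arg_maxP _ _ _ (Ordinal n0) xpredT (fun k : 'I_n => Z k) isT.
  by exists k0 => // k kn; apply: (kmax (Ordinal kn)).
(* [Z k - Z k0] lies in [-2, 0], as [k0] maximizes [Z]; adding 1 centers the range. *)
pose X k := s (w k) * outer w k * (Z k - Z k0 + 1).
have [F1 [F2 [F1m F2m F0 FX]]] := circuit_values X cw.
have Xb k : (k < n)%N -> `|X k| <= 1.
  move=> kn; have := kmax k kn; have := Zrange k0 k k0n kn; rewrite /X.
  by case: (ss (w k)) => ->; case: (outer_sgn w k) => ->; lia.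
exists F1, F2; split=> // [v|v /(circuit_mem _ cw)[k kn ->]].
  have [/(circuit_mem _ cw)[k kn ->]|/F0[-> ->]//] := boolP (v \in orb r).
  have [pk _ _] := prvP kn evn.
  by have [-> ->] := FX k kn; split; case: ifP => _; apply: Xb.
have [pk op np] := prvP kn evn.
have -> : o1 (w k) * F1 (w k) + o2 (w k) * F2 (w k) =
          outer w k * X k + inner w k * X (prv n k).
  by have [-> ->] := FX k kn; rewrite /outer /inner; case: odd; rewrite // addrC.
have out_in : s (w (prv n k)) * outer w (prv n k) = - (s (w k) * inner w k).
  have [] := pot (w k); first by apply/(circuit_mem _ cw); exists k.
  have [-> ->] := circuit_step cw kn; rewrite /outer /inner op.
  by case: (odd k).
have ZZ : Z k = Z (prv n k) - s (w k) * d (w k).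
  rewrite /prv; case: eqP => [->|/eqP k0'].
    by rewrite Zn /Z big_ord_recr big_ord0 /= !add0r.
  by rewrite /Z prednK ?lt0n // big_ord_recr /= opprD.
rewrite {2}/X out_in /X ZZ.
by case: (ss (w k)) => ->; case: (outer_sgn w k) => ->; case: (inner_sgn w k) => ->; lia.
Qed.

(** Summation by parts: the sum over vertices is regrouped by the edges of the circuit. *)
Lemma circuit_sum r n w (g F1 F2 : V -> int) : circuit_walk m1 m2 r n w ->
  (forall v, F1 (m1 v) = F1 v) -> (forall v, F2 (m2 v) = F2 v) ->
  \sum_(v in orb r) g v * (o1 v * F1 v + o2 v * F2 v) =
  \sum_(k < n) (if odd k then F2 (w k) else F1 (w k)) *
    (g (w k) * outer w k + g (w (nxt n k)) * inner w (nxt n k)).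
Proof.
move=> cw i1 i2; have [/andP[n0 evn] _ _ _ _] := cw.
pose X k := if odd k then F2 (w k) else F1 (w k).
have E k : (k < n)%N -> g (w k) * (o1 (w k) * F1 (w k) + o2 (w k) * F2 (w k)) =
    g (w k) * outer w k * X k + g (w k) * inner w k * X (prv n k).
  move=> kn; have [pk op _] := prvP kn evn; have [e1 e2] := circuit_step cw kn.
  rewrite /X op /outer /inner; case: (odd k) e1 e2 => /= e1 e2.
    by rewrite -e1 i1; ring.
  by rewrite -e2 i2; ring.
rewrite (circuit_big _ _ cw) (eq_bigr _ (fun (k : 'I_n) _ => E k (ltn_ord k))).
pose nxt_ord (k : 'I_n) := Ordinal (nxt_ltn (ltn_ord k)).
rewrite big_split /= [X in _ + X](reindex_inj (h := nxt_ord)) /=.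
  rewrite -big_split /=; apply: eq_bigr => k _.
  by have [_ ->] := nxtP (ltn_ord k) evn; rewrite -/(X k); ring.
move=> i j /(congr1 val) /= e; apply: val_inj => /=.
have [_ <-] := nxtP (ltn_ord i) evn; have [_ <-] := nxtP (ltn_ord j) evn.
by rewrite e.
Qed.
End CircuitFlows.

(** [eta] prescribes where the two values cancel (1) and where they reinforce each other (-1).
    Absorbed into [o2], it leaves a balanced circuit; its potential, multiplied by signs alternating
    around the circuit, gives values that agree at both ends of every edge. *)
Lemma orb_signs (V : finType) (m1 m2 : V -> V) (o1 o2 eta : V -> int) r :
  matching m1 -> matching m2 -> (forall v, sgn (o1 v)) -> (forall v, sgn (o2 v)) ->
  (forall v, sgn (eta v)) ->
  \prod_(v in orb m1 m2 r) (o1 v * o2 v * eta v) = 1 ->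
  exists F1 F2 : V -> int, [/\ forall v, F1 (m1 v) = F1 v,
    forall v, F2 (m2 v) = F2 v, forall v, v \notin orb m1 m2 r -> F1 v = 0 /\ F2 v = 0 &
    forall v, v \in orb m1 m2 r -> [/\ sgn (F1 v), sgn (F2 v) &
      o1 v * F1 v = - (eta v * (o2 v * F2 v))]].
Proof.
move=> mm1 mm2 os1 os2 etas par.
have os2' v : sgn (eta v * o2 v) by apply: sgnM.
have [|s [ss pot]] := orb_potential mm1 mm2 os1 os2' (r := r).
  by rewrite -[RHS]par; apply: eq_bigr => v _; ring.
have [side hside] := orb_side mm1 mm2 r.
pose t v : int := if side v then 1 else -1.
exists (fun v => if v \in orb m1 m2 r then t v * s v * o1 v else 0).
exists (fun v => if v \in orb m1 m2 r then - (t v * s v * (eta v * o2 v)) else 0).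
split=> [v|v|v /negbTE->//|v vr].
- rewrite orb_m1 //; case: ifP => // vr; have [e1 _] := pot v vr.
  rewrite -mulrA e1 /t (hside v vr).1; case: (side v) => /=; ring.
- rewrite orb_m2 //; case: ifP => // vr; have [_ e1] := pot v vr.
  rewrite -mulrA e1 /t (hside v vr).2; case: (side v) => /=; ring.
have ts : sgn (t v) by rewrite /t; case: (side v); [left|right].
rewrite vr; split; [|apply: sgnN|]; do ?apply: sgnM => //.
by case: (os1 v) => ->; case: (os2 v) => ->; case: (etas v) => ->; ring.
Qed.

(** * Partial flows with demands *)

Section Glue.
Variables (V : finType) (m1 m2 m3 : V -> V) (o1 o2 o3 : V -> int).
Hypotheses (mm1 : matching m1) (mm2 : matching m2) (mm3 : matching m3).
Hypotheses (os1 : forall v, sgn (o1 v)) (os2 : forall v, sgn (o2 v))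
  (os3 : forall v, sgn (o3 v)).

Definition inv3 (F1 F2 F3 : V -> int) :=
  [/\ forall v, F1 (m1 v) = F1 v, forall v, F2 (m2 v) = F2 v &
      forall v, F3 (m3 v) = F3 v].

(* F1, F2, F3 are the flow values on the edges of the three colors at a vertex,
   o1, o2, o3 the orientations of the corresponding half edges, and d is the
   imbalance left to be compensated from outside S. *)
Definition sol (S : {set V}) (d F1 F2 F3 : V -> int) :=
  [/\ inv3 F1 F2 F3,
      forall v, v \notin S -> [/\ F1 v = 0, F2 v = 0 & F3 v = 0] &
      forall v, o1 v * F1 v + o2 v * F2 v + o3 v * F3 v + d v = 0].

Lemma sol_scale c S d F1 F2 F3 : sol S d F1 F2 F3 ->
  sol S (fun v => c * d v) (fun v => c * F1 v) (fun v => c * F2 v) (fun v => c * F3 v).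
Proof.
move=> [[i1 i2 i3] s0 e]; split=> [|v /s0[-> -> ->]|v].
- by split=> v; rewrite ?i1 ?i2 ?i3.
- by rewrite mulr0.
- by rewrite -[RHS](mulr0 c) -(e v); ring.
Qed.

Lemma sol_add S S' d d' F1 F2 F3 G1 G2 G3 :
  sol S d F1 F2 F3 -> sol S' d' G1 G2 G3 ->
  sol (S :|: S') (fun v => d v + d' v) (fun v => F1 v + G1 v)
      (fun v => F2 v + G2 v) (fun v => F3 v + G3 v).
Proof.
move=> [[i1 i2 i3] s0 e] [[j1 j2 j3] t0 e']; split=> [|v|v].
- by split=> v; rewrite ?i1 ?i2 ?i3 ?j1 ?j2 ?j3.
- by rewrite inE negb_or => /andP[/s0[-> -> ->] /t0[-> -> ->]].
- by rewrite -[RHS]addr0 -{1}(e v) -(e' v); ring.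
Qed.

Lemma sol_link p x : sol [set p; m3 p]
  (fun v => - (o3 v * (if v \in [set p; m3 p] then x else 0))) (fun=> 0) (fun=> 0)
  (fun v => if v \in [set p; m3 p] then x else 0).
Proof.
have [K3 _] := mm3; split=> [|v /negbTE->//|v]; last by ring.
split=> // v; rewrite !inE !(inv_eq K3) K3 orbC.
by congr (if _ then _ else _); rewrite -[v == m3 p](inv_eq K3) // K3 eq_sym.
Qed.

(** The bounds on the third color do not add up: the edge at [p] leaves both [S] and [S'], so [F3]
    and [G3] vanish on it and it carries [x] alone. *)
Lemma sol_glue S S' d d' e F1 F2 F3 G1 G2 G3 p x :
  sol S d F1 F2 F3 -> sol S' d' G1 G2 G3 -> [disjoint S & S'] ->
  p \in S -> m3 p \in S' ->
  (forall v, e v = d v + d' v - (if v \in [set p; m3 p] then o3 v * x else 0)) ->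
  exists H1 H2 H3, [/\ sol (S :|: S') e H1 H2 H3,
    forall v, v \in S -> H1 v = F1 v /\ H2 v = F2 v,
    forall v, v \in S' -> H1 v = G1 v /\ H2 v = G2 v &
    forall v, [\/ H3 v = x, H3 v = F3 v | H3 v = G3 v]].
Proof.
move=> sF sG dis pS qS' hd.
have [inv0 off0 eq0] := sol_add (sol_add sF sG) (sol_link p x).
have [[_ _ iF] F0 _] := sF; have [[_ _ iG] G0 _] := sG.
have SnS' v : v \in S -> v \notin S' by move=> vS; rewrite (disjointFr dis).
have S'nS v : v \in S' -> v \notin S by move=> vS; rewrite (disjointFl dis).
have Fq : F3 (m3 p) = 0 by have [] := F0 _ (S'nS _ qS').
have Gp : G3 p = 0 by have [] := G0 _ (SnS' _ pS).
eexists; eexists; eexists; split; first split.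
- exact: inv0.
- move=> v vn; apply: off0; move: vn; rewrite !inE !negb_or => /andP[vS vS'].
  rewrite vS vS' /=; apply/andP; split; first by apply: contraNneq vS => ->.
  by apply: contraNneq vS' => ->.
- move=> v; rewrite -[RHS](eq0 v) hd; case: ifP => _; ring.
- by move=> v vS; have [-> -> _] := G0 v (SnS' v vS); rewrite !addr0.
- by move=> v vS; have [-> -> _] := F0 v (S'nS v vS); rewrite !addr0 !add0r.
move=> v /=; case: ifP => [|_].
  rewrite !inE => /orP[] /eqP ->; first by rewrite -iF Fq Gp !add0r; constructor.
  by rewrite iG Fq Gp !add0r; constructor.
have [vS|vS] := boolP (v \in S).
  by have [_ _ ->] := G0 v (SnS' v vS); rewrite !addr0; constructor 2.
by have [_ _ ->] := F0 v vS; rewrite add0r addr0; constructor 3.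
Qed.

Section Growth.
Variable cell : V -> {set V}.
Hypothesis cell_refl : forall v, v \in cell v.
Hypothesis cell_eq : forall v w, w \in cell v -> cell w = cell v.

Definition cell_closed (S : {set V}) := forall v, v \in S -> cell v \subset S.

Lemma cell_disjoint S q : cell_closed S -> q \notin S -> [disjoint S & cell q].
Proof.
move=> clS qS; apply/pred0P => v /=; apply/negbTE/negP => /andP[vS vq].
by move: qS; rewrite (subsetP (clS v vS)) // (cell_eq vq).
Qed.

(** Cells are abstract because they are circuits in one application, while in another the vertices
    of one distinguished circuit count as singletons. *)
Lemma growth (ok : pred V) (P : {set V} -> Prop) r : P (cell r) ->
  (forall S p, cell_closed S -> r \in S -> P S -> p \in S -> m3 p \notin S ->
     ok (m3 p) -> P (S :|: cell (m3 p))) ->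
  exists S, [/\ cell_closed S, r \in S, P S &
    forall p, p \in S -> ok (m3 p) -> m3 p \in S].
Proof.
move=> Pr grow.
suff H n S : (#|~: S| < n)%N -> cell_closed S -> r \in S -> P S ->
    exists S, [/\ cell_closed S, r \in S, P S &
      forall p, p \in S -> ok (m3 p) -> m3 p \in S].
  apply: (H _ (cell r)) => // v /cell_eq ->; exact: subxx.
elim: n S => // n IH S; rewrite ltnS => ltn clS rS PS.
have [/exists_inP[p pS /andP[okp npS]]|/exists_inPn stuck] :=
    boolP [exists p in S, ok (m3 p) && (m3 p \notin S)]; last first.
  exists S; split=> // p pS okp; have := stuck p pS.
  by rewrite okp /= negbK.
apply: (IH (S :|: cell (m3 p))).
- apply: leq_trans ltn; apply: proper_card; rewrite properE setCS subsetUl /=.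
  rewrite setCS; apply: contra npS => /subsetP; apply.
  by rewrite inE cell_refl orbT.
- move=> v; rewrite inE => /orP[vS|vc].
    by apply: subset_trans (clS v vS) (subsetUl _ _).
  by rewrite (cell_eq vc) subsetUr.
- by rewrite inE rS.
- exact: grow.
Qed.
End Growth.
End Glue.

(** * Pairing up unbalanced circuits *)

Section EvenFlows.
Variables (V : finType) (m1 m2 m3 : V -> V) (o1 o2 o3 : V -> int).
Hypotheses (mm1 : matching m1) (mm2 : matching m2) (mm3 : matching m3).
Hypotheses (os1 : forall v, sgn (o1 v)) (os2 : forall v, sgn (o2 v))
  (os3 : forall v, sgn (o3 v)).

Local Notation orb := (orb m1 m2).
Local Notation sol := (sol m1 m2 m3 o1 o2 o3).
Implicit Types (S E : {set V}) (d : V -> int).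

Definition sg E v : int := if v \in E then -1 else 1.
(** For [S] an orbit and [E] empty this is the sign of the circuit; each point of [E] in [S]
    reverses it. *)
Definition parity S E : int := \prod_(v in S) (o1 v * o2 v * sg E v).

Lemma sg_sgn E v : sgn (sg E v). Proof. by rewrite /sg; case: ifP; [right|left]. Qed.

Lemma parity_sgn S E : sgn (parity S E).
Proof. by apply: sgn_prod => v _; do ?apply: sgnM => //; apply: sg_sgn. Qed.

Lemma parityU S S' E : [disjoint S & S'] ->
  parity (S :|: S') E = parity S E * parity S' E.
Proof.
by move=> dis; rewrite /parity -bigU //=; apply: eq_bigl => v; rewrite !inE.
Qed.

Lemma parity_toggle S E p : p \in S -> p \notin E ->
  parity S (p |: E) = - parity S E.
Proof.
move=> pS pE; rewrite /parity !(bigD1 p pS) /= /sg !inE eqxx (negbTE pE) /=.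
rewrite mulrN1 mulr1 mulNr; congr (- (_ * _)); apply: eq_bigr => v /andP[_ vp].
by rewrite !inE (negbTE vp).
Qed.

Lemma parity_off S E E' : {in S, E =i E'} -> parity S E = parity S E'.
Proof. by move=> h; apply: eq_bigr => v vS; rewrite /sg h. Qed.

(** A point of [E] exchanges flow through its edge of the third color, which therefore has to leave
    [S]. *)
Definition dangling S E := forall v, v \in E -> v \in S -> m3 v \notin S.

(* S admits flows with values +-1 on the first two colors that exchange +-2 with
   the outside at exactly the vertices of E. *)
Definition even_solvable S := forall E, dangling S E -> parity S E = 1 ->
  exists d F1 F2 F3, [/\ sol S d F1 F2 F3,
    forall v, v \in S -> `|F1 v| = 1 /\ `|F2 v| = 1,
    forall v, `|F3 v| <= 2 &
    forall v, `|d v| = if (v \in E) && (v \in S) then 2 else 0].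

Lemma sgn_norm x : sgn x -> `|x| = 1. Proof. by case=> ->. Qed.

(** This is [orb_signs] with [sg E] for [eta]: two values +-1 that reinforce each other leave
    +-2. *)
Lemma orb_even_solution r E : parity (orb r) E = 1 ->
  exists d F1 F2, [/\ sol (orb r) d F1 F2 (fun=> 0),
    forall v, v \in orb r -> `|F1 v| = 1 /\ `|F2 v| = 1 &
    forall v, `|d v| = if (v \in E) && (v \in orb r) then 2 else 0].
Proof.
move=> par; have [F1 [F2 [i1 i2 F0 FS]]] :=
  orb_signs mm1 mm2 os1 os2 (sg_sgn E) par.
exists (fun v => - (o1 v * F1 v + o2 v * F2 v)), F1, F2; split.
- split=> // [v /F0[-> ->] //|v]; ring.
- by move=> v /FS[s1 s2 _]; rewrite !sgn_norm.
move=> v; have [vr|/F0[-> ->]] := boolP (v \in orb r); last first.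
  by rewrite andbF !mulr0 addr0 oppr0.
have [s1 s2 ->] := FS v vr; rewrite andbT /sg.
by case: ifP => _; case: (os2 v) => ->; case: s2 => ->.
Qed.

Lemma orb_even_solvable r : even_solvable (orb r).
Proof.
move=> E _ /orb_even_solution[d [F1 [F2 [sF b1 bd]]]].
by exists d, F1, F2, (fun=> 0); split.
Qed.

(* The sign of the second solution is free, so it can be made to agree with the
   first one along the link. *)
Lemma link_value p d d' c : `|d p| = c -> `|d' (m3 p)| = c ->
  exists x k, [/\ sgn k, `|x| = c, d p = o3 p * x & k * d' (m3 p) = o3 (m3 p) * x].
Proof.
move=> dp dq; exists (o3 p * d p).
have [e|e] := eqVneq (d' (m3 p)) (o3 (m3 p) * (o3 p * d p)).
  exists 1; split; [by left| | |by rewrite e mul1r].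
    by case: (os3 p) => ->; lia.
  by case: (os3 p) => ->; ring.
exists (-1); split; [by right| | |].
- by case: (os3 p) => ->; lia.
- by case: (os3 p) => ->; ring.
- by case: (os3 p) e => ->; case: (os3 (m3 p)) => ->; lia.
Qed.

Lemma orb_closed_disjoint S q : cell_closed orb S -> q \notin S ->
  [disjoint S & orb q].
Proof. exact: (cell_disjoint (orb_refl m1 m2) (orb_eq mm1 mm2)). Qed.

Lemma sol_off S d F1 F2 F3 v : sol S d F1 F2 F3 -> v \notin S -> d v = 0.
Proof.
by move=> [_ F0 eF] vS; have := eF v; have [-> -> ->] := F0 v vS; rewrite !mulr0 !add0r.
Qed.

Lemma sol_join S C d d' F1 F2 F3 G1 G2 G3 p c :
  sol S d F1 F2 F3 -> sol C d' G1 G2 G3 -> [disjoint S & C] ->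
  p \in S -> m3 p \in C -> `|d p| = c -> `|d' (m3 p)| = c ->
  exists e H1 H2 H3, [/\ sol (S :|: C) e H1 H2 H3,
    forall v, v \in S -> [/\ `|H1 v| = `|F1 v|, `|H2 v| = `|F2 v| &
      `|e v| = if v == p then 0 else `|d v|],
    forall v, v \in C -> [/\ `|H1 v| = `|G1 v|, `|H2 v| = `|G2 v| &
      `|e v| = if v == m3 p then 0 else `|d' v|] &
    forall v, [\/ `|H3 v| = c, `|H3 v| = `|F3 v| | `|H3 v| = `|G3 v|]].
Proof.
move=> sF sG dis pS qC dp dq.
have [x [k [sk xc ex ex']]] := link_value dp dq.
pose e v := d v + k * d' v - (if v \in [set p; m3 p] then o3 v * x else 0).
have [H1 [H2 [H3 [sH HS HC H3v]]]] := sol_glue mm3 sF (sol_scale k sG) dis pS qC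
  (e := e) (x := x) (fun v => erefl).
have nk y : `|k * y| = `|y| by rewrite normrM sgn_norm ?mul1r.
exists e, H1, H2, H3; split=> // [v vS|v vC|v]; last first.
- by case: (H3v v) => ->; rewrite ?nk; [constructor|constructor 2|constructor 3].
- have [-> ->] := HC v vC; rewrite !nk; split=> //.
  have vnS : v \notin S by rewrite (disjointFl dis).
  have -> : e v = if v == m3 p then 0 else k * d' v.
    rewrite /e (sol_off sF vnS) add0r !inE.
    have -> : (v == p) = false by apply: contraNF vnS => /eqP->.
    by case: eqP => [->|_] /=; rewrite ?ex' ?subrr ?subr0.
  by case: ifP => _; rewrite ?normr0 ?nk.
have [-> ->] := HS v vS; split=> //.
have vnC : v \notin C by rewrite (disjointFr dis).
rewrite /e (sol_off sG vnC) mulr0 addr0 !inE.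
have -> : (v == m3 p) = false by apply: contraNF vnC => /eqP->.
by rewrite orbF; case: eqP => [->|_]; rewrite ?ex ?subrr ?normr0 ?subr0.
Qed.

Section GrowStep.
Variables (S E : {set V}) (p : V).
Hypotheses (clS : cell_closed orb S) (pS : p \in S) (qS : m3 p \notin S).
Hypothesis (dE : dangling (S :|: orb (m3 p)) E).
Let q := m3 p.
Let C := orb q.

Lemma step_disjoint : [disjoint S & C].
Proof. exact: orb_closed_disjoint. Qed.

Lemma step_endpoints : p \notin E /\ q \notin E.
Proof.
have qC : q \in C := orb_refl m1 m2 q.
split; apply/negP => h; have := dE h; rewrite !in_setU ?(proj1 mm3) pS -/q qC orbT;
  by move/(_ isT).
Qed.

Lemma step_dangling : dangling S (p |: (q |: E)) /\ dangling S E.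
Proof.
suff d0 : dangling S E.
  split=> // v; rewrite !in_setU1 => /or3P[/eqP->|/eqP->|]; [by []| |exact: d0].
  by rewrite (negbTE qS).
move=> v vE vS; have := dE vE; rewrite !in_setU vS => /(_ isT).
by rewrite negb_or => /andP[].
Qed.

Lemma step_parity : parity S (p |: (q |: E)) = - parity S E /\
  parity C (p |: (q |: E)) = - parity C E.
Proof.
have qC : q \in C := orb_refl m1 m2 q; have dis := step_disjoint.
have [pE qE] := step_endpoints; have [_ N3] := mm3.
have pC : p \notin C by rewrite (disjointFr dis).
split.
  rewrite parity_toggle //; last by rewrite in_setU1 eq_sym (negbTE (N3 p)).
  congr (- _); apply: parity_off => v vS; rewrite in_setU1.
  by case: eqP => // vq; move: qS; rewrite -/q -vq vS.
rewrite -(parity_toggle qC qE); apply: parity_off => v vC; rewrite in_setU1.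
by case: eqP => // vp; rewrite -vp vC in pC.
Qed.

(** Since the parities of [S] and [C] multiply to 1, they are both 1 or both -1. In the second case
    adding both ends of the link to [E] repairs both, and the link will carry +-2. *)
Lemma step_choice : parity (S :|: C) E = 1 -> exists A : {set V},
  [/\ (p \in A) = (q \in A), {in [predC [set p; q]], A =i E}, dangling S A,
      parity S A = 1 & parity C A = 1].
Proof.
rewrite (parityU _ step_disjoint) => par; have [pE qE] := step_endpoints.
have [parS parC] := step_parity; have [dE' dE0] := step_dangling.
have [parS1|nparS1] := eqVneq (parity S E) 1.
  by exists E; split=> //; [rewrite (negbTE pE) (negbTE qE)|rewrite parS1 mul1r in par].
exists (p |: (q |: E)); split=> //.
- by rewrite !inE !eqxx !orbT.
- by move=> v; rewrite !inE negb_or => /andP[/negbTE-> /negbTE->].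
- by rewrite parS; case: (parity_sgn S E) nparS1 => ->.
- by rewrite parC; case: (parity_sgn S E) nparS1 par => ->; case: (parity_sgn C E) => ->.
Qed.
End GrowStep.

Lemma even_solvable_grow S p : cell_closed orb S -> even_solvable S ->
  p \in S -> m3 p \notin S -> even_solvable (S :|: orb (m3 p)).
Proof.
move=> clS evS pS qS E dE par; have dis := step_disjoint clS qS.
have [pE qE] := step_endpoints pS dE.
have qC : m3 p \in orb (m3 p) := orb_refl m1 m2 (m3 p).
have [A [pA EA dA pSA pCA]] := step_choice clS pS qS dE par.
move: (orb_even_solution (r := m3 p)) dis qC pCA {dE par}.
move: (orb (m3 p)) => C solC dis qC pCA.
have vCS v : v \in C -> v \notin S by move=> h; rewrite (disjointFl dis).
have [d [F1 [F2 [F3 [sF bF b3 bd]]]]] := evS A dA pSA.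
have [d' [G1 [G2 [sG bG bd']]]] := solC A pCA.
pose c : int := if p \in A then 2 else 0.
have [||e [H1 [H2 [H3 [sH HS HC H3b]]]]] := sol_join (c := c) sF sG dis pS qC.
- by rewrite bd pS andbT.
- by rewrite bd' -pA qC andbT.
exists e, H1, H2, H3; split=> // [v|v|v].
- rewrite in_setU => /orP[vS|vC]; first by have [-> -> _] := HS v vS; apply: bF.
  by have [-> -> _] := HC v vC; apply: bG.
- by case: (H3b v) => ->; rewrite // /c; case: ifP.
rewrite in_setU; have [vS|vS] := boolP (v \in S).
  have [_ _ ->] := HS v vS; rewrite andbT; case: eqP => [->|/eqP vp].
    by rewrite (negbTE pE).
  rewrite bd vS andbT EA // !inE negb_or vp.
  by apply: contraNneq (vCS _ qC) => <-.
have [vC|vC] := boolP (v \in C).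
  have [_ _ ->] := HC v vC; rewrite andbT; case: eqP => [->|/eqP vp].
    by rewrite (negbTE qE).
  rewrite bd' vC andbT EA // !inE negb_or vp andbT.
  by apply: contraNneq vS => ->.
by rewrite andbF (sol_off sH) // in_setU negb_or vS.
Qed.

(* As before, with values up to 3 and 4, and an additional exchange of +-4 at a. *)
Definition quad_solvable S := forall E a, a \in S -> a \notin E -> m3 a \notin S ->
  dangling S E -> parity S E = 1 ->
  exists d F1 F2 F3, [/\ sol S d F1 F2 F3,
    forall v, v \in S -> 1 <= `|F1 v| <= 3 /\ 1 <= `|F2 v| <= 3,
    forall v, `|F3 v| <= 4 &
    forall v, `|d v| = if v == a then 4 else if (v \in E) && (v \in S) then 2 else 0].

(* The solution for E plus twice a solution for {a} or, on a balanced circuit, for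
   {z, a} with z in E. *)
Lemma orb_quad r E a : a \in orb r -> a \notin E -> parity (orb r) E = 1 ->
  parity (orb r) set0 = -1 \/ (exists2 z, z \in E & z \in orb r) ->
  exists d F1 F2, [/\ sol (orb r) d F1 F2 (fun=> 0),
    forall v, v \in orb r -> 1 <= `|F1 v| <= 3 /\ 1 <= `|F2 v| <= 3 &
    forall v, `|d v| =
      if v == a then 4 else if (v \in E) && (v \in orb r) then 2 else 0].
Proof.
move=> ar aE parE hyp; have [d [F1 [F2 [sF bF bd]]]] := orb_even_solution parE.
have combine W : parity (orb r) W = 1 -> a \in W ->
    (forall v, v \in W -> v != a -> v \in E /\ v \in orb r) ->
    (forall v w, v \in W -> w \in W -> v != a -> w != a -> v = w) ->
  exists d F1 F2, [/\ sol (orb r) d F1 F2 (fun=> 0),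
    forall v, v \in orb r -> 1 <= `|F1 v| <= 3 /\ 1 <= `|F2 v| <= 3 &
    forall v, `|d v| =
      if v == a then 4 else if (v \in E) && (v \in orb r) then 2 else 0].
  move=> parW aW WE W1; have [d' [G1 [G2 [sG bG bd']]]] := orb_even_solution parW.
  have [k sk kW] : exists2 k, sgn k & forall v, v \in W -> v != a ->
      `|d v + 2 * k * d' v| = 2.
    have [/existsP[z /andP[zW za]]|no] := boolP [exists z, (z \in W) && (z != a)].
      have [zE zr] := WE z zW za.
      have uz : `|d z| = 2 by rewrite bd zE zr.
      have wz : `|d' z| = 2 by rewrite bd' zW zr.
      exists (if d z == d' z then -1 else 1).
        by case: ifP => _; [right|left].
      move=> v vW va; rewrite (W1 v z vW zW va za).
      by move: (d z) (d' z) uz wz => y y'; clear; case: eqP; lia.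
    exists 1; first by left.
    by move=> v vW va; move/existsPn: no => /(_ v); rewrite vW va.
  exists (fun v => d v + 2 * k * d' v), (fun v => F1 v + 2 * k * G1 v),
    (fun v => F2 v + 2 * k * G2 v); split.
  - have := sol_add sF (sol_scale (2 * k) sG); rewrite setUid.
    case=> -[i1 i2 _] h0 he; split; [by split| |].
      by move=> v /h0[-> -> _].
    by move=> v; rewrite -[RHS](he v); ring.
  - move=> v vr; have [] := bF v vr; have [] := bG v vr.
    by case: sk => ->; lia.
  move=> v; have := bd' v; have := bd v; case: eqP => [->|/eqP va].
    by rewrite (negbTE aE) aW ar /=; case: sk => ->; lia.
  have [vW|vW] := boolP (v \in W); last first.
    by move=> e /eqP; rewrite normr_eq0 => /eqP ->; rewrite mulr0 addr0.
  by rewrite kW //; have [-> ->] := WE v vW va.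
have par_a : parity (orb r) [set a] = - parity (orb r) set0.
  by rewrite -(parity_toggle ar) ?inE // setU0.
have [unb|bal] := eqVneq (parity (orb r) set0) (-1).
  apply: (combine [set a]); rewrite ?par_a ?unb ?opprK ?inE //.
  - by move=> v /set1P->; rewrite eqxx.
  - by move=> v w /set1P-> /set1P->.
case: hyp => [e|[z zE zr]]; first by rewrite e in bal.
have za : z != a by apply: contraNneq aE => <-.
apply: (combine [set z; a]); rewrite ?inE ?eqxx ?orbT //.
- rewrite (parity_toggle zr) ?in_set1 // par_a opprK.
  by case: (parity_sgn (orb r) set0) bal => ->.
- by move=> v /set2P[]->; rewrite ?eqxx.
- by move=> v w /set2P[]-> /set2P[]->; rewrite ?eqxx.
Qed.

Lemma quad_solvable_orb r : parity (orb r) set0 = -1 -> quad_solvable (orb r).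
Proof.
move=> unb E a ar aE _ _ parE.
have [d [F1 [F2 [sF bF bd]]]] := orb_quad ar aE parE (or_introl unb).
by exists d, F1, F2, (fun=> 0); split.
Qed.

(** If [a] lies in [S], only [S] needs a quad solution. If [a] lies on the new circuit [C], either
    [C] can produce the 4 by itself through [orb_quad], or [C] is balanced without points of [A] and
    merely forwards a 4 received from [S]. *)
Lemma quad_solvable_grow S p : cell_closed orb S -> even_solvable S ->
  quad_solvable S -> p \in S -> m3 p \notin S -> quad_solvable (S :|: orb (m3 p)).
Proof.
move=> clS evS quS pS qS E a aSC aE qaSC dE par; have dis := step_disjoint clS qS.
have [pE qE] := step_endpoints pS dE.
have qC : m3 p \in orb (m3 p) := orb_refl m1 m2 (m3 p).
have [A [pA EA dA pSA pCA]] := step_choice clS pS qS dE par.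
move: (orb_even_solution (r := m3 p)) (orb_quad (r := m3 p)) (@parity_toggle (orb (m3 p))).
move: dis qC pCA aSC qaSC (@parity_off (orb (m3 p))) {dE par}.
move: (orb (m3 p)) => C dis qC pCA aSC qaSC offC solC quadC toggleC.
have vSC v : v \in S -> v \notin C by move=> h; rewrite (disjointFr dis).
have vCS v : v \in C -> v \notin S by move=> h; rewrite (disjointFl dis).
have [K3 N3] := mm3.
have ap : a != p.
  by apply: contraNneq qaSC => ->; rewrite in_setU qC orbT.
have aq : a != m3 p.
  by apply: contraNneq qaSC => ->; rewrite K3 in_setU pS.
have aA : a \notin A by rewrite EA // !inE negb_or ap aq.
pose D v : int := if v == a then 4 else if (v \in E) && (v \in S :|: C) then 2 else 0.
have ES v : v \in S -> v != p -> (v \in A) = (v \in E).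
  move=> vS vp; apply: EA; rewrite !inE negb_or vp /=.
  by apply: contraNneq (vCS _ qC) => <-.
have EC v : v \in C -> v != m3 p -> (v \in A) = (v \in E).
  move=> vC vq; apply: EA; rewrite !inE negb_or vq andbT.
  by apply: contraNneq (vSC _ pS) => <-.
have finish c d d' F1 F2 F3 G1 G2 G3 :
    sol S d F1 F2 F3 -> sol C d' G1 G2 G3 -> `|d p| = c -> `|d' (m3 p)| = c -> c <= 4 ->
    (forall v, v \in S -> 1 <= `|F1 v| <= 3 /\ 1 <= `|F2 v| <= 3) ->
    (forall v, v \in C -> 1 <= `|G1 v| <= 3 /\ 1 <= `|G2 v| <= 3) ->
    (forall v, `|F3 v| <= 4) -> (forall v, `|G3 v| <= 4) ->
    (forall v, v \in S -> v != p -> `|d v| = D v) ->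
    (forall v, v \in C -> v != m3 p -> `|d' v| = D v) ->
    exists d F1 F2 F3, [/\ sol (S :|: C) d F1 F2 F3,
      forall v, v \in S :|: C -> 1 <= `|F1 v| <= 3 /\ 1 <= `|F2 v| <= 3,
      forall v, `|F3 v| <= 4 & forall v, `|d v| = D v].
  move=> sF sG dp dq c4 bF bG b3 b3' dS dC.
  have [e [H1 [H2 [H3 [sH HS HC H3b]]]]] := sol_join sF sG dis pS qC dp dq.
  exists e, H1, H2, H3; split=> // [v|v|v].
  - rewrite in_setU => /orP[vS|vC]; first by have [-> -> _] := HS v vS; apply: bF.
    by have [-> -> _] := HC v vC; apply: bG.
  - by case: (H3b v) => ->.
  have [vS|vS] := boolP (v \in S).
    have [_ _ ->] := HS v vS; case: eqP => [->|/eqP vp]; last exact: dS.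
    by rewrite /D eq_sym (negbTE ap) (negbTE pE).
  have [vC|vC] := boolP (v \in C).
    have [_ _ ->] := HC v vC; case: eqP => [->|/eqP vp]; last exact: dC.
    by rewrite /D eq_sym (negbTE aq) (negbTE qE).
  have vSC' : v \notin S :|: C by rewrite in_setU negb_or vS.
  rewrite (sol_off sH) // /D (negbTE vSC') andbF; case: eqP => // va.
  by rewrite -va (negbTE vSC') in aSC.
pose c : int := if p \in A then 2 else 0.
have c4 : c <= 4 by rewrite /c; case: ifP.
move: aSC; rewrite in_setU.
have [aS _|aS /= aC] := boolP (a \in S).
  have qaS : m3 a \notin S by move: qaSC; rewrite in_setU negb_or => /andP[].
  have [d [F1 [F2 [F3 [sF bF b3 bd]]]]] := quS A a aS aA qaS dA pSA.
  have [d' [G1 [G2 [sG bG bd']]]] := solC A pCA.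
  apply: (finish c _ _ _ _ _ _ _ _ sF sG) => //.
  - by rewrite bd eq_sym (negbTE ap) pS andbT.
  - by rewrite bd' -pA qC andbT.
  - by move=> v /bG[-> ->].
  - by move=> v vS vp; rewrite bd /D in_setU vS !andbT ES.
  - move=> v vC vq; rewrite bd' /D in_setU vC orbT !andbT EC //.
    by case: eqP => // va; rewrite -va (negbTE (vCS _ vC)) in aS.
have spread : parity C set0 = -1 \/ (exists2 z, z \in A & z \in C) ->
    exists d F1 F2 F3, [/\ sol (S :|: C) d F1 F2 F3,
      forall v, v \in S :|: C -> 1 <= `|F1 v| <= 3 /\ 1 <= `|F2 v| <= 3,
      forall v, `|F3 v| <= 4 & forall v, `|d v| = D v].
  move=> hyp; have [d' [G1 [G2 [sG bG bd']]]] := quadC A a aC aA pCA hyp.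
  have [d [F1 [F2 [F3 [sF bF b3 bd]]]]] := evS A dA pSA.
  apply: (finish c _ _ _ _ _ _ _ _ sF sG) => //.
  - by rewrite bd pS andbT.
  - by rewrite bd' eq_sym (negbTE aq) -pA qC andbT.
  - by move=> v /bF[-> ->].
  - by move=> v; apply: le_trans (b3 v) _.
  - move=> v vS vp; rewrite bd /D in_setU vS !andbT ES //.
    by case: eqP => // va; rewrite -va vS in aS.
  - by move=> v vC vq; rewrite bd' /D in_setU vC orbT !andbT EC.
have [e|bal] := eqVneq (parity C set0) (-1); first by apply: spread; left.
have [/exists_inP[z zA zC]|/exists_inPn no] := boolP [exists z in A, z \in C].
  by apply: spread; right; exists z.
have qA : m3 p \notin A by apply/negP => /no; rewrite qC.
(* Forwarding: twice a solution with exchanges at [a] and [m3 p] takes 4 in at [m3 p] and passes it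
   out at [a], while [S] exchanges 4 at [p]. *)
have [|d' [G1 [G2 [sG bG bd']]]] := solC [set a; m3 p].
  rewrite toggleC ?in_set1 // -[[set m3 p]]setU0 toggleC ?inE // opprK.
  by case: (parity_sgn C set0) bal => ->.
have pA0 : p \notin A by rewrite pA.
have qS' : m3 p \notin S := qS.
have [d [F1 [F2 [F3 [sF bF b3 bd]]]]] := quS A p pS pA0 qS' dA pSA.
apply: (finish 4 _ _ _ _ _ _ _ _ sF (sol_scale 2 sG)) => //.
- by rewrite bd eqxx.
- by rewrite normrM bd' !inE eqxx orbT qC.
- by move=> v /bG[]; rewrite !normrM => -> ->.
- move=> v vS vp; rewrite bd /D (negbTE vp) in_setU vS !andbT ES //.
  by case: eqP => // va; rewrite -va vS in aS.
move=> v vC vq; rewrite normrM bd' !inE (negbTE vq) orbF vC andbT /D.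
case: eqP => // va; rewrite -EC //; have := no v; case: (v \in A) => //.
by move=> /(_ isT); rewrite vC.
Qed.
End EvenFlows.

(** * Flows on the whole graph built from one pair of colors *)

Section GlobalFlows.
Variables (V : finType) (m1 m2 m3 : V -> V) (o1 o2 o3 : V -> int).
Hypotheses (mm1 : matching m1) (mm2 : matching m2) (mm3 : matching m3).
Hypotheses (os1 : forall v, sgn (o1 v)) (os2 : forall v, sgn (o2 v))
  (os3 : forall v, sgn (o3 v)).

Local Notation orb := (orb m1 m2).
Local Notation sol := (sol m1 m2 m3 o1 o2 o3).
Local Notation parity := (parity o1 o2).
Local Notation unbal v := (parity (orb v) set0 = -1).

Definition linked := forall (A : {set V}) v, v \in A ->
  (forall w, w \in A -> [/\ m1 w \in A, m2 w \in A & m3 w \in A]) -> A = setT.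

Definition hflow F1 F2 F3 := sol setT (fun=> 0) F1 F2 F3.

Hypothesis conn : linked.

Lemma cell_closed_m12 S v : cell_closed orb S -> v \in S -> m1 v \in S /\ m2 v \in S.
Proof.
move=> clS vS; have /subsetP h := clS v vS.
by split; apply: h; rewrite ?orb_m1 ?orb_m2 // orb_refl.
Qed.

Lemma even_flow (r : V) : parity setT set0 = 1 -> exists F1 F2 F3,
  [/\ hflow F1 F2 F3, forall v, `|F1 v| = 1 /\ `|F2 v| = 1 & forall v, `|F3 v| <= 2].
Proof.
move=> par; have [S [clS rS evS S3]] := growth (orb_refl m1 m2) (orb_eq mm1 mm2)
  (ok := predT) (@orb_even_solvable V m1 m2 m3 o1 o2 o3 mm1 mm2 os1 os2 r)
  (fun S p clS _ evS pS qS _ => even_solvable_grow mm1 mm2 mm3 os1 os2 os3 clS evS pS qS).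
have ST : S = setT.
  apply: (conn rS) => w wS; have [? ?] := cell_closed_m12 clS wS.
  by split=> //; apply: S3.
have [||d [F1 [F2 [F3 [sF bF b3 bd]]]]] := evS set0; first by move=> v; rewrite inE.
  by rewrite ST.
exists F1, F2, F3; split=> // [|v]; last by apply: bF; rewrite ST.
case: sF => i F0 eF; split=> // [v|v]; first by rewrite inE.
have dv : d v = 0 by apply/eqP; rewrite -normr_eq0 bd inE.
by rewrite -[RHS](eF v) dv.
Qed.

(** Solutions on separate circuits do not interact; one is chosen per circuit, indexed by the root
    of its component. *)
Lemma balanced_flow (T : {set V}) :
  (forall v, v \in T -> [/\ m1 v \in T, m2 v \in T & parity (orb v) set0 = 1]) ->
  exists F1 F2, sol T (fun=> 0) F1 F2 (fun=> 0) /\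
    forall v, v \in T -> `|F1 v| = 1 /\ `|F2 v| = 1.
Proof.
move=> hT.
have ex r : exists FF : (V -> int) * (V -> int), r \in T ->
    sol (orb r) (fun=> 0) FF.1 FF.2 (fun=> 0) /\
    forall v, v \in orb r -> `|FF.1 v| = 1 /\ `|FF.2 v| = 1.
  have [rT|_] := boolP (r \in T); last by exists (fun=> 0, fun=> 0).
  have [_ _ bal] := hT r rT.
  have [d [F1 [F2 [[i F0 eF] bF bd]]]] := orb_even_solution m3 o3 mm1 mm2 os1 os2 bal.
  exists (F1, F2) => _; split=> //; split=> // v.
  have dv : d v = 0 by apply/eqP; rewrite -normr_eq0 bd inE.
  by rewrite -[RHS](eF v) dv.
have [F hF] := fin_all_exists ex; pose rt := fingraph.root (alt_rel m1 m2).
have as_ := alt_sym mm1 mm2.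
have rt_orb v w : w \in orb v -> rt w = rt v.
  by rewrite inE => /(fingraph.rootP as_).
have vrt v : v \in orb (rt v) by rewrite inE as_ connect_root.
have rtT v : v \in T -> rt v \in T.
  move=> vT; have sub : orb v \subset T.
    by apply: orb_min => // w /hT[? ? _].
  by apply: (subsetP sub); rewrite inE connect_root.
exists (fun v => if v \in T then (F (rt v)).1 v else 0).
exists (fun v => if v \in T then (F (rt v)).2 v else 0).
have T1 v : (m1 v \in T) = (v \in T).
  by apply/idP/idP => /hT[h _ _] //; rewrite (proj1 mm1) in h.
have T2 v : (m2 v \in T) = (v \in T).
  by apply/idP/idP => /hT[_ h _] //; rewrite (proj1 mm2) in h.
split; first split; first split.
- move=> v; rewrite T1; case: ifP => // vT.
  rewrite (rt_orb v) ?orb_m1 ?orb_refl //.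
  by have [[[i _ _] _ _] _] := hF _ (rtT v vT).
- move=> v; rewrite T2; case: ifP => // vT.
  rewrite (rt_orb v) ?orb_m2 ?orb_refl //.
  by have [[[_ i _] _ _] _] := hF _ (rtT v vT).
- by [].
- by move=> v /negbTE ->.
- move=> v; case: ifP => vT; last by rewrite !mulr0 !addr0.
  by have [[_ _ e] _] := hF _ (rtT v vT); apply: e.
by move=> v vT; rewrite vT; have [_] := hF _ (rtT v vT); apply.
Qed.

(** A +-1 flow gives o1 o2 = - F1 F2 at each vertex, and the products of [F1], of [F2] and of -1
    over [T] are 1, since each is constant on the pairs of a matching. *)
Lemma parity_balanced (T : {set V}) :
  (forall v, v \in T -> [/\ m1 v \in T, m2 v \in T & parity (orb v) set0 = 1]) ->
  parity T set0 = 1.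
Proof.
move=> hT; have [F1 [F2 [[[i1 i2 _] _ e] b]]] := balanced_flow hT.
have c1 v : v \in T -> m1 v \in T by case/hT.
have c2 v : v \in T -> m2 v \in T by case/hT.
have s1 v : v \in T -> sgn (F1 v) by case/b => + _; rewrite /sgn; lia.
have s2 v : v \in T -> sgn (F2 v) by case/b => _; rewrite /sgn; lia.
have p1 := matching_prod mm1 c1 i1 s1; have p2 := matching_prod mm2 c2 i2 s2.
have p0 := matching_prod mm1 (F := fun=> -1) c1 (fun=> erefl) (fun _ _ => or_intror erefl).
rewrite -[RHS](mulr1 1) -[X in X * _]p1 -[X in _ * X](mulr1 1) -[X in _ * (X * _)]p2.
rewrite -[X in _ * (_ * X)]p0 -!big_split /=; apply: eq_bigr => v vT.
have := e v; rewrite /sg inE mulr0 !addr0 mulr1.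
case: (s1 v vT) => ->; case: (s2 v vT) => ->; case: (os1 v) => ->;
  by case: (os2 v) => ->.
Qed.

(* S is grown from an unbalanced circuit while leaving out the circuit of z; when
   some other unbalanced circuit is missed, z is moved there and the old one is
   absorbed into S.  In the end the circuit of z carries +-2 and is joined to S by
   an edge of value +-4. *)
Lemma odd_flow x y : unbal x -> unbal y -> y \notin orb x -> parity setT set0 = -1 ->
  exists F1 F2 F3, [/\ hflow F1 F2 F3,
    forall v, 1 <= `|F1 v| <= 3 /\ 1 <= `|F2 v| <= 3 & forall v, `|F3 v| <= 4].
Proof.
move=> ux uy yx parT.
pose good (S : {set V}) z := [/\ cell_closed orb S, even_solvable m1 m2 m3 o1 o2 o3 S,
  quad_solvable m1 m2 m3 o1 o2 o3 S, unbal z & z \notin S].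
have good_grow S z p w : good S z -> p \in S -> m3 p \notin S -> unbal w ->
    w \notin S -> w \notin orb (m3 p) -> good (S :|: orb (m3 p)) w.
  move=> [clS evS quS _ _] pS qS uw wS wq; split=> //.
  - move=> v; rewrite in_setU => /orP[vS|vq].
      by apply: subset_trans (clS v vS) (subsetUl _ _).
    by rewrite (orb_eq mm1 mm2 vq) subsetUr.
  - exact: even_solvable_grow.
  - exact: quad_solvable_grow.
  - by rewrite in_setU negb_or wS.
have grow_lt (S : {set V}) p : m3 p \notin S -> (#|~: (S :|: orb (m3 p))| < #|~: S|)%N.
  move=> qS; apply: proper_card; rewrite properE setCS subsetUl /=.
  rewrite setCS; apply: contra qS => /subsetP; apply.
  by rewrite in_setU orb_refl orbT.
have [S [z [p [[clS evS quS uz zS] pS pz max]]]] : exists (S : {set V}) z p, [/\ good S z, p \in S,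
    m3 p \in orb z & forall w, unbal w -> w \in S \/ w \in orb z].
  suff H n (S : {set V}) z : (#|~: S| < n)%N -> good S z -> (exists v, v \in S) ->
      exists (S : {set V}) z p, [/\ good S z, p \in S, m3 p \in orb z &
        forall w, unbal w -> w \in S \/ w \in orb z].
    apply: (H _ (orb x) y (leqnn _)); last by exists x; apply: orb_refl.
    split=> //; first by move=> v /(orb_eq mm1 mm2) ->.
      exact: orb_even_solvable.
    exact: quad_solvable_orb.
  elim: n S z => // n IH S z; rewrite ltnS => ltn gS [v vS].
  have [clS evS quS uz zS] := gS.
  have [/exists_inP[p pS /andP[qS qz]]|/exists_inPn stop] :=
      boolP [exists p in S, (m3 p \notin S) && (m3 p \notin orb z)].
    apply: (IH (S :|: orb (m3 p)) z).
    - by apply: leq_trans ltn; apply: grow_lt.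
    - apply: (good_grow S z p z) => //; apply: contra qz => zq.
      by rewrite (orb_eq mm1 mm2 zq) orb_refl.
    - by exists v; rewrite in_setU vS.
  have [/exists_inP[p pS qS]|/exists_inPn stop'] := boolP [exists p in S, m3 p \notin S];
      last first.
    move: zS; rewrite (conn vS) ?inE // => w wS.
    have [? ?] := cell_closed_m12 clS wS; split=> //.
    by have := stop' w wS; rewrite negbK.
  have qz : m3 p \in orb z by have := stop p pS; rewrite qS /= negbK.
  have [/existsP[w /and3P[/eqP uw wS wz]]|/existsPn all] := boolP [exists w,
      [&& parity (orb w) set0 == -1, w \notin S & w \notin orb z]]; last first.
    exists S, z, p; split=> // w uw; have := all w; rewrite uw eqxx /= negb_and !negbK.
    by case/orP; [left|right].
  apply: (IH (S :|: orb (m3 p)) w).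
  - by apply: leq_trans ltn; apply: grow_lt.
  - by apply: (good_grow S z p w) => //; rewrite (orb_eq mm1 mm2 qz).
  - by exists v; rewrite in_setU vS.
have qS : m3 p \notin S.
  by apply: contra zS => /clS /subsetP; apply; rewrite (orb_eq mm1 mm2 pz) orb_refl.
have dis : [disjoint S & orb z].
  by apply: (orb_closed_disjoint mm1 mm2 clS).
pose T := ~: (S :|: orb z).
have SC1 v : (m1 v \in S :|: orb z) = (v \in S :|: orb z).
  rewrite !in_setU orb_m1 //; congr (_ || _); apply/idP/idP => /(cell_closed_m12 clS)[h _] //.
  by rewrite (proj1 mm1) in h.
have SC2 v : (m2 v \in S :|: orb z) = (v \in S :|: orb z).
  rewrite !in_setU orb_m2 //; congr (_ || _); apply/idP/idP => /(cell_closed_m12 clS)[_ h] //.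
  by rewrite (proj1 mm2) in h.
have hT v : v \in T -> [/\ m1 v \in T, m2 v \in T & parity (orb v) set0 = 1].
  rewrite !in_setC SC1 SC2 => vT; split=> //.
  case: (parity_sgn os1 os2 (orb v) set0) => // uv; move: vT; rewrite in_setU.
  by case: (max v uv) => ->; rewrite ?orbT.
(* The total parity and that of the circuit of [z] are -1 and the remaining circuits are balanced,
   so [S] can be solved with [E] empty. *)
have parS : parity S set0 = 1.
  have : parity setT set0 = parity S set0 * parity (orb z) set0 * parity T set0.
    rewrite -parityU // -parityU ?setUCr //.
    by rewrite disjoints_subset setCK.
  rewrite parT uz (parity_balanced hT).
  by case: (parity_sgn os1 os2 S set0) => ->.
have dang0 : dangling m3 S set0 by move=> v; rewrite inE.
have p0 : p \notin set0 by rewrite inE.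
have [d [F1 [F2 [F3 [sF bF b3 bd]]]]] := quS set0 p pS p0 qS dang0 parS.
(* Doubling this solution gives +-2 on the circuit and +-4 at [m3 p], matching the 4 that [S] offers
   at [p]. *)
have [|d' [G1 [G2 [sG bG bd']]]] := orb_even_solution m3 o3 mm1 mm2 os1 os2
    (r := z) (E := [set m3 p]).
  by rewrite -[[set m3 p]]setU0 (parity_toggle o1 o2 pz) ?inE // uz.
have dp : `|d p| = 4 by rewrite bd eqxx.
have dq : `|2 * d' (m3 p)| = 4 by rewrite normrM bd' in_set1 eqxx pz.
have [e [H1 [H2 [H3 [sH HS HC H3b]]]]] :=
  sol_join mm3 os3 sF (sol_scale 2 sG) dis pS pz dp dq.
have [K1 [K2 [sK bK]]] := balanced_flow hT.
have e0 v : e v = 0.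
  have [vS|vS] := boolP (v \in S).
    have [_ _] := HS v vS; rewrite bd inE /=.
    by case: eqP => _ /eqP; rewrite normr_eq0 => /eqP.
  have [vC|vC] := boolP (v \in orb z); last first.
    by rewrite (sol_off sH) // in_setU negb_or vS.
  have [_ _] := HC v vC; rewrite normrM bd' in_set1.
  by case: eqP => _ /eqP; rewrite ?andFb ?mulr0 normr_eq0 => /eqP.
have [iJ J0 eJ] := sol_add sH sK; rewrite setUCr in J0.
exists (fun v => H1 v + K1 v), (fun v => H2 v + K2 v), (fun v => H3 v + 0); split.
- by split=> // v; rewrite -[RHS](eJ v) e0 addr0.
- move=> v; have [vT|vT] := boolP (v \in T).
    have [_ H0 _] := sH; have [-> -> _] := H0 v ltac:(by move: vT; rewrite in_setC).
    by have [b1 b2] := bK v vT; rewrite !add0r b1 b2.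
  have [_ K0 _] := sK; have [-> -> _] := K0 v vT; rewrite !addr0.
  move: vT; rewrite in_setC negbK in_setU => /orP[vS|vC].
    by have [-> -> _] := HS v vS; apply: bF.
  by have [-> -> _] := HC v vC; rewrite !normrM; have [-> ->] := bG v vC.
- by move=> v; rewrite addr0; case: (H3b v) => ->; rewrite ?mulr0.
Qed.
End GlobalFlows.

(** * A single unbalanced circuit *)

Section OneUnbalanced.
Variables (V : finType) (m1 m2 m3 : V -> V) (o1 o2 o3 : V -> int).
Hypotheses (mm1 : matching m1) (mm2 : matching m2) (mm3 : matching m3).
Hypotheses (os1 : forall v, sgn (o1 v)) (os2 : forall v, sgn (o2 v))
  (os3 : forall v, sgn (o3 v)).

Local Notation orb := (orb m1 m2).
Local Notation sol := (sol m1 m2 m3 o1 o2 o3).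
Local Notation parity := (parity o1 o2).
Local Notation potential := (potential m1 m2 o1 o2).

Variable x : V.
Local Notation C0 := (orb x).
Hypothesis unbx : parity C0 set0 = -1.
Hypothesis balanced_off : forall v, v \notin C0 -> parity (orb v) set0 = 1.
Hypothesis conn : linked m1 m2 m3.

(** Singletons on [C0], because the edges of [C0] are deleted while the remaining circuits stay
    whole. *)
Definition cell v : {set V} := if v \in C0 then [set v] else orb v.

Lemma cell_refl v : v \in cell v.
Proof. by rewrite /cell; case: ifP => _; rewrite ?set11 ?orb_refl. Qed.

Lemma cell_eq v w : w \in cell v -> cell w = cell v.
Proof.
rewrite /cell; case: ifP => [vC /set1P-> |vC wv]; first by rewrite vC.
have e := orb_eq mm1 mm2 wv; rewrite e; case: ifP => // wC.
by rewrite -(orb_eq mm1 mm2 wC) e orb_refl in vC.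
Qed.

(* Connectivity after deleting the edges of the circuit C0. *)
Definition comp_rel : rel V := fun u v =>
  (v == m3 u) || (u \notin C0) && ((v == m1 u) || (v == m2 u)).

Definition comp r : {set V} := [set v | connect comp_rel r v].

Lemma comp_sym : connect_sym comp_rel.
Proof.
have [[K1 _] [K2 _] [K3 _]] := And3 mm1 mm2 mm3.
apply: sym_connect_sym => u v; rewrite /comp_rel.
have h a b : comp_rel a b -> comp_rel b a.
  rewrite /comp_rel => /orP[/eqP->|/andP[aC /orP[]/eqP->]].
  - by rewrite K3 eqxx.
  - by rewrite orb_m1 // aC K1 eqxx orbT.
  - by rewrite orb_m2 // aC K2 eqxx !orbT.
by apply/idP/idP; apply: h.
Qed.

Lemma comp_refl r : r \in comp r. Proof. by rewrite inE. Qed.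

Lemma comp_m3 r v : v \in comp r -> m3 v \in comp r.
Proof.
by rewrite !inE => h; apply: connect_trans h (connect1 _); rewrite /comp_rel eqxx.
Qed.

Lemma comp_m12 r v : v \in comp r -> v \notin C0 -> m1 v \in comp r /\ m2 v \in comp r.
Proof.
by move=> + vC; rewrite !inE => h; split; apply: connect_trans h (connect1 _);
  rewrite /comp_rel vC eqxx ?orbT.
Qed.

Definition rt v := fingraph.root comp_rel v.

Lemma comp_rt r v : (v \in comp r) = (rt v == rt r).
Proof. by rewrite inE comp_sym /rt root_connect //; exact: comp_sym. Qed.

Lemma rt_m3 v : rt (m3 v) = rt v.
Proof. by apply/eqP; rewrite -comp_rt comp_m3 ?comp_refl. Qed.

Lemma rt_m12 v : v \notin C0 -> rt (m1 v) = rt v /\ rt (m2 v) = rt v.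
Proof.
by move=> vC; have [? ?] := comp_m12 (comp_refl v) vC; split; apply/eqP; rewrite -comp_rt.
Qed.

Lemma rt_rt v : rt (rt v) = rt v.
Proof. exact: (root_root comp_sym). Qed.

(** * Routing demands through the components outside the unbalanced circuit *)

Definition mask (S : {set V}) (d : V -> int) v : int := if v \in S then d v else 0.

Definition solves_demands (S : {set V}) (s : V -> int) := forall d,
  \sum_(v in S) s v * d v = 0 -> \sum_(v in S) `|d v| <= 4 ->
  exists F1 F2 F3, [/\ sol S (mask S d) F1 F2 F3,
    forall v, v \in C0 -> F1 v = 0 /\ F2 v = 0,
    forall v, `|F1 v| <= 1 /\ `|F2 v| <= 1 & forall v, `|F3 v| <= 2].

Definition demand_ok (S : {set V}) := exists s, [/\ forall v, sgn (s v),
  potential (S :\: C0) s & solves_demands S s].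

Lemma demand_ok_cell r : demand_ok (cell r).
Proof.
rewrite /cell; case: ifP => rC.
  exists (fun=> 1); split=> [v|v|d]; first by left.
    by rewrite in_setD in_set1 => /andP[+ /eqP e]; rewrite e rC.
  rewrite !big_set1 mul1r => dr _; exists (fun=> 0), (fun=> 0), (fun=> 0); split=> //.
  split=> // v; rewrite !mulr0 !add0r /mask inE.
  by case: eqP => // ->.
have := balanced_off (negbT rC); rewrite /parity => bal.
have [|s [ss pot]] := orb_potential mm1 mm2 os1 os2 (r := r).
  by rewrite -[RHS]bal; apply: eq_bigr => v _; rewrite /sg inE mulr1.
exists s; split=> // [v|d sum0 sum4]; first by rewrite in_setD => /andP[_ /pot].
have [F1 [F2 [i1 i2 F0 b e]]] := orb_demand mm1 mm2 os1 os2 ss pot sum0 sum4.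
exists F1, F2, (fun=> 0); split=> // [|v vC].
  split=> // [v /F0[-> ->] //|v]; rewrite mulr0 addr0 /mask.
  by case: ifP => [/e //|/negbT/F0[-> ->]]; rewrite !mulr0 !addr0.
by apply: F0; apply/negP => vr; move: rC; rewrite -(orb_eq mm1 mm2 vC) (orb_eq mm1 mm2 vr) orb_refl.
Qed.

Lemma cell_closed_step S v : cell_closed cell S -> v \in S -> v \notin C0 ->
  m1 v \in S /\ m2 v \in S.
Proof.
move=> clS vS vC; have /subsetP h := clS v vS.
by split; apply: h; rewrite /cell (negbTE vC) ?orb_m1 ?orb_m2 // orb_refl.
Qed.

Lemma sum_setU (S C : {set V}) (f : V -> int) : [disjoint S & C] ->
  \sum_(v in S :|: C) f v = \sum_(v in S) f v + \sum_(v in C) f v.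
Proof. by move=> dis; rewrite -bigU //=; apply: eq_bigl => v; rewrite !inE. Qed.

Lemma sum_mask1 (S : {set V}) (f : V -> int) a : a \in S ->
  \sum_(v in S) (if v == a then f v else 0) = f a.
Proof.
by move=> aS; rewrite -big_mkcondr (big_pred1 a) // => v /=; case: eqP => [->|]; rewrite ?aS ?andbF.
Qed.

(** The potential of the new cell is negated if needed to make the link consistent. The link carries
    the net demand [D], whose size is at most the total demand on either side: neither side gets
    more than 4, and 2|D| <= 4. *)
Lemma demand_ok_grow S p : cell_closed cell S -> demand_ok S -> p \in S ->
  m3 p \notin S -> demand_ok (S :|: cell (m3 p)).
Proof.
move=> clS [s [ss pot solS]] pS qS.
have [t [ts pot' solC]] := demand_ok_cell (m3 p).
have dis := cell_disjoint cell_refl cell_eq clS qS.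
have qC := cell_refl (m3 p); have clC : cell_closed cell (cell (m3 p)).
  by move=> v /cell_eq ->.
move: (cell (m3 p)) => C in t ts pot' solC dis qC clC *.
have vSC v : v \in S -> v \notin C by move=> h; rewrite (disjointFr dis).
have vCS v : v \in C -> v \notin S by move=> h; rewrite (disjointFl dis).
have [k sk kq] : exists2 k, sgn k & s p * o3 p + k * t (m3 p) * o3 (m3 p) = 0.
  exists (- (s p * o3 p * t (m3 p) * o3 (m3 p))).
    by apply: sgnN; do ?apply: sgnM.
  by case: (ts (m3 p)) => ->; case: (os3 (m3 p)) => ->; ring.
pose u v := if v \in S then s v else k * t v.
have us v : sgn (u v) by rewrite /u; case: ifP => _; [exact: ss|exact: sgnM].
have uS v : v \in S -> u v = s v by rewrite /u => ->.
have uC v : v \in C -> u v = k * t v by move=> /vCS; rewrite /u => /negbTE ->.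
exists u; split=> //.
  move=> v; rewrite in_setD in_setU => /andP[vC0 /orP[vS|vC]].
    have [vS1 vS2] := cell_closed_step clS vS vC0.
    by rewrite !uS //; apply: pot; rewrite in_setD vC0.
  have [vC1 vC2] := cell_closed_step clC vC vC0.
  rewrite !uC // -!mulrA; have [|-> ->] := pot' v; first by rewrite in_setD vC0.
  by rewrite !mulrN.
move=> d; rewrite !(sum_setU _ dis) => sum0 sum4.
set D := \sum_(v in C) u v * d v in sum0.
have DC : D = k * \sum_(v in C) t v * d v.
  by rewrite /D mulr_sumr; apply: eq_bigr => v /uC ->; rewrite mulrA.
have DS : \sum_(v in S) s v * d v = - D.
  have -> : \sum_(v in S) s v * d v = \sum_(v in S) u v * d v.
    by apply: eq_bigr => v /uS ->.
  by move: sum0; set A := \sum_(v in S) _; lia.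
have absD (A : {set V}) : `|\sum_(v in A) u v * d v| <= \sum_(v in A) `|d v|.
  apply: le_trans (ler_norm_sum _ _ _) _; apply: ler_sum => v _.
  by rewrite normrM sgn_norm ?mul1r.
have leD : `|D| <= \sum_(v in C) `|d v| := absD C.
have leD' : `|D| <= \sum_(v in S) `|d v|.
  by move/eqP: sum0; rewrite addr_eq0 => /eqP e; have := absD S; rewrite e normrN.
pose dS v := d v + (if v == p then s p * D else 0).
pose dC v := d v + (if v == m3 p then - (k * t (m3 p) * D) else 0).
have [||F1 [F2 [F3 [sF F0 bF b3]]]] := solS dS.
- rewrite /dS; under eq_bigr => v _ do rewrite mulrDr.
  rewrite big_split /= DS.
  under eq_bigr => v _ do rewrite (fun_if ( *%R (s v))) mulr0.
  by rewrite (sum_mask1 (fun v => s v * (s p * D)) pS); case: (ss p) => ->; lia.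
- apply: (@le_trans _ _ (\sum_(v in S) (`|d v| + (if v == p then `|D| else 0)))).
    apply: ler_sum => v _; rewrite /dS; case: eqP => _; last by rewrite !addr0.
    by case: (ss p) => ->; lia.
  by rewrite big_split /= (sum_mask1 (fun v => `|D|) pS) (le_trans _ sum4) ?lerD.
have [||G1 [G2 [G3 [sG G0 bG b3']]]] := solC dC.
- rewrite /dC; under eq_bigr => v _ do rewrite mulrDr.
  rewrite big_split /=.
  under [X in _ + X]eq_bigr => v _ do rewrite (fun_if ( *%R (t v))) mulr0.
  rewrite (sum_mask1 (fun v => t v * - (k * t (m3 p) * D)) qC).
  move: DC; set A := \sum_(v in C) _ => ->.
  by case: (ts (m3 p)) => ->; case: sk => ->; lia.
- apply: (@le_trans _ _ (\sum_(v in C) (`|d v| + (if v == m3 p then `|D| else 0)))).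
    apply: ler_sum => v _; rewrite /dC; case: eqP => _; last by rewrite !addr0.
    by case: (ts (m3 p)) => ->; case: sk => ->; lia.
  by rewrite big_split /= (sum_mask1 (fun v => `|D|) qC) addrC (le_trans _ sum4) ?lerD.
pose y := o3 p * s p * D.
have ye : o3 (m3 p) * y = - (k * t (m3 p) * D).
  rewrite /y; move: kq; case: (os3 p) => ->; case: (os3 (m3 p)) => ->;
  by case: (ss p) => ->; case: sk => ->; case: (ts (m3 p)) => ->; lia.
have pq : p != m3 p by rewrite eq_sym (proj2 mm3).
have he v : mask (S :|: C) d v =
    mask S dS v + mask C dC v - (if v \in [set p; m3 p] then o3 v * y else 0).
  rewrite /mask /dS /dC in_setU in_set2.
  have [->|vp] := eqVneq v p.
    by rewrite pS (negbTE (vSC _ pS)) /= /y; case: (os3 p) => ->; lia.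
  have [->|vq] := eqVneq v (m3 p).
    by rewrite qC (negbTE (vCS _ qC)) /= ye; lia.
  rewrite /= subr0 !addr0; have [vS|vS] /= := boolP (v \in S).
    by rewrite (negbTE (vSC _ vS)) addr0.
  by rewrite add0r.
have [H1 [H2 [H3 [sH HS HC H3v]]]] := sol_glue mm3 sF sG dis pS qC he.
have outside v : v \notin S -> v \notin C -> H1 v = 0 /\ H2 v = 0.
  by move=> vS vC; have [_ H0 _] := sH; have [|-> ->] := H0 v; rewrite // in_setU negb_or vS.
have leD2 : `|D| <= 2.
  have : `|D| + `|D| <= 4 by rewrite (le_trans _ sum4) // addrC lerD.
  by lia.
exists H1, H2, H3; split=> // v.
- move=> vC0; have [vS|vS] := boolP (v \in S); first by have [-> ->] := HS v vS; apply: F0.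
  have [vC|vC] := boolP (v \in C); first by have [-> ->] := HC v vC; apply: G0.
  exact: outside.
- have [vS|vS] := boolP (v \in S); first by have [-> ->] := HS v vS; apply: bF.
  have [vC|vC] := boolP (v \in C); first by have [-> ->] := HC v vC; apply: bG.
  by have [-> ->] := outside v vS vC.
- case: (H3v v) => -> //; rewrite /y.
  by case: (os3 p) => ->; case: (ss p) => ->; lia.
Qed.

Lemma demand_ok_comp r : demand_ok (comp r).
Proof.
have cell_comp v : v \in comp r -> cell v \subset comp r.
  move=> vr; rewrite /cell; case: ifP => vC; first by rewrite sub1set.
  pose T := comp r :&: ~: C0.
  have : orb v \subset T.
    apply: orb_min; first by rewrite in_setI vr in_setC vC.
    move=> w; rewrite !in_setI !in_setC orb_m1 // orb_m2 // => /andP[wr wC].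
    by have [-> ->] := comp_m12 wr wC; rewrite wC.
  by move/subset_trans; apply; apply: subsetIl.
have [S [clS rS [subS okS] S3]] := growth cell_refl cell_eq (ok := predT)
  (P := fun S => S \subset comp r /\ demand_ok S)
  (conj (cell_comp r (comp_refl r)) (demand_ok_cell r))
  (fun S p clS _ PS pS qS _ =>
     conj (introT subUsetP (conj PS.1 (cell_comp _ (comp_m3 (subsetP PS.1 p pS)))))
          (demand_ok_grow clS PS.2 pS qS)).
suff -> : comp r = S by [].
apply/eqP; rewrite eqEsubset subS andbT; apply/subsetP => v; rewrite inE.
case/connectP => p; elim: p r rS {subS cell_comp} => [|w p IH] u uS /= => [_ -> //|].
case/andP => uw pw vl; apply: (IH w) => //.
case/orP: uw => [/eqP->|/andP[uC /orP[]/eqP->]]; first exact: S3.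
- by have [] := cell_closed_step clS uS uC.
- by have [] := cell_closed_step clS uS uC.
Qed.

(** Components are independent, so potential and solution at a vertex are those chosen for the root
    of its component. *)
Lemma demand_flow : exists s, [/\ forall v, sgn (s v), potential (~: C0) s &
  forall d, (forall r, \sum_(v in comp r) s v * d v = 0 /\
                       \sum_(v in comp r) `|d v| <= 4) ->
    exists F1 F2 F3, [/\ sol setT d F1 F2 F3,
      forall v, v \in C0 -> F1 v = 0 /\ F2 v = 0,
      forall v, `|F1 v| <= 1 /\ `|F2 v| <= 1 & forall v, `|F3 v| <= 2]].
Proof.
have [s hs] := fin_all_exists demand_ok_comp.
exists (fun v => s (rt v) v); split=> [v|v|d hd].
- by have [] := hs (rt v).
- rewrite in_setC => vC; have [-> ->] := rt_m12 vC.
  have [_ pot _] := hs (rt v); apply: pot.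
  by rewrite in_setD vC comp_rt rt_rt eqxx.
have ex r : exists F : (V -> int) * (V -> int) * (V -> int), r = rt r ->
    [/\ sol (comp r) (mask (comp r) d) F.1.1 F.1.2 F.2,
      forall v, v \in C0 -> F.1.1 v = 0 /\ F.1.2 v = 0,
      forall v, `|F.1.1 v| <= 1 /\ `|F.1.2 v| <= 1 & forall v, `|F.2 v| <= 2].
  have [e|ne] := eqVneq r (rt r); last first.
    by exists (fun=> 0, fun=> 0, fun=> 0) => e; rewrite -e eqxx in ne.
  have [_ _ sols] := hs r; have [sum0 sum4] := hd r.
  have [|//|F1 [F2 [F3 hF]]] := sols d.
    rewrite -[RHS]sum0; apply: eq_bigr => v; rewrite comp_rt => /eqP ->.
    by rewrite -e.
  by exists (F1, F2, F3).
have [F hF'] := fin_all_exists ex.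
have hF v := hF' (rt v) (esym (rt_rt v)).
have inrt v : v \in comp (rt v) by rewrite comp_rt rt_rt.
exists (fun v => (F (rt v)).1.1 v), (fun v => (F (rt v)).1.2 v), (fun v => (F (rt v)).2 v).
have z1 v : v \in C0 -> (F (rt v)).1.1 v = 0 /\ (F (rt v)).1.2 v = 0.
  by have [_ z _ _] := hF v; apply: z.
split=> // [|v|v]; last 2 first.
- by have [_ _ + _] := hF v; apply.
- by have [_ _ _ +] := hF v; apply.
split; first split.
- move=> v; have [vC|vC] := boolP (v \in C0).
    have [-> _] := z1 v vC; suff /z1[-> _] : m1 v \in C0 by [].
    by rewrite orb_m1.
  have [-> _] := rt_m12 vC.
  by have [[[i _ _] _ _] _ _ _] := hF v; apply: i.
- move=> v; have [vC|vC] := boolP (v \in C0).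
    have [_ ->] := z1 v vC; suff /z1[_ ->] : m2 v \in C0 by [].
    by rewrite orb_m2.
  have [_ ->] := rt_m12 vC.
  by have [[[_ i _] _ _] _ _ _] := hF v; apply: i.
- by move=> v; rewrite rt_m3; have [[[_ _ i] _ _] _ _ _] := hF v; apply: i.
- by move=> v; rewrite inE.
- by move=> v; have [[_ _ e] _ _ _] := hF v; rewrite -[RHS](e v) /mask inrt.
Qed.

Lemma comp_meets r : exists2 a, a \in C0 & a \in comp r.
Proof.
have [/exists_inP[a ? ?]|/exists_inPn no] := boolP [exists a in C0, a \in comp r].
  by exists a.
have offC v : v \in comp r -> v \notin C0 by move=> vr; apply/negP => /no; rewrite vr.
have := no x (orb_refl _ _ _); rewrite (conn (comp_refl r)) ?inE // => w wr.
by have [? ?] := comp_m12 wr (offC w wr); split=> //; apply: comp_m3.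
Qed.

(** * Covering the unbalanced circuit by a flow *)

Definition unbalanced_profile := exists F1 F2 F3, [/\ hflow m1 m2 m3 o1 o2 o3 F1 F2 F3,
  forall v, v \in C0 -> 1 <= `|F1 v| <= 3 /\ 1 <= `|F2 v| <= 3,
  forall v, v \notin C0 -> `|F1 v| <= 1 /\ `|F2 v| <= 1 &
  forall v, `|F3 v| <= 3].

Lemma sum_delta (S : {set V}) (f : V -> int) a :
  \sum_(v in S) f v * (v == a)%:R = f a * (a \in S)%:R.
Proof.
have [aS|aS] := boolP (a \in S).
  rewrite -(sum_mask1 (fun v => f v) aS) mulr1; apply: eq_bigr => v _.
  by case: eqP; rewrite ?mulr1 ?mulr0.
rewrite mulr0 big1 // => v vS; case: eqP => [e|_]; last by rewrite mulr0.
by rewrite -e vS in aS.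
Qed.

(** The edge at [p] is inconsistent with the potential, so one unit on it creates a net demand of
    +-2, which the component carries to a vertex [a] of [C0]. There the unbalanced [C0], with values
    +-1, supplies +-2. The demands total 2 + 1 + 1, and the extra unit raises the bound on the third
    color from 2 to 3. *)
Lemma barbell_flow s p : (forall v, sgn (s v)) ->
  (forall d, (forall r, \sum_(v in comp r) s v * d v = 0 /\
                       \sum_(v in comp r) `|d v| <= 4) ->
    exists F1 F2 F3, [/\ sol setT d F1 F2 F3,
      forall v, v \in C0 -> F1 v = 0 /\ F2 v = 0,
      forall v, `|F1 v| <= 1 /\ `|F2 v| <= 1 & forall v, `|F3 v| <= 2]) ->
  s p * o3 p + s (m3 p) * o3 (m3 p) != 0 -> unbalanced_profile.
Proof.
move=> ss solve pincons.
have [a aC ap] := comp_meets p.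
have [|d0 [G1 [G2 [sG bG bd0]]]] := orb_even_solution m3 o3 mm1 mm2 os1 os2
    (r := x) (E := [set a]).
  by rewrite -[[set a]]setU0 (parity_toggle o1 o2 aC) ?inE // unbx.
have d0a : `|d0 a| = 2 by rewrite bd0 in_set1 eqxx aC.
have d00 v : v != a -> d0 v = 0.
  by move=> va; apply/eqP; rewrite -normr_eq0 bd0 in_set1 (negbTE va).
(* The solution on [C0] may be negated; this matches its +-2 at [a] with the demand created at
   [p]. *)
have [k sk kE] : exists2 k, sgn k &
    - (k * (s a * d0 a)) + s p * o3 p + s (m3 p) * o3 (m3 p) = 0.
  exists (if s a * d0 a == s p * o3 p + s (m3 p) * o3 (m3 p) then 1 else -1).
    by case: ifP => _; [left|right].
  move: pincons d0a; case: (ss p) => ->; case: (ss (m3 p)) => ->; case: (ss a) => ->;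
  by case: (os3 p) => ->; case: (os3 (m3 p)) => -> /eqP pc da; case: eqP; lia.
pose d v := - (k * d0 a) * (v == a)%:R + o3 p * (v == p)%:R
            + o3 (m3 p) * (v == m3 p)%:R.
have qp : m3 p != p := proj2 mm3 p.
have [r|F1 [F2 [F3 [sF F0 bF b3]]]] := solve d.
  have pa : (p \in comp r) = (a \in comp r).
    by rewrite !comp_rt; move: ap; rewrite comp_rt => /eqP ->.
  have qa : (m3 p \in comp r) = (a \in comp r) by rewrite -pa !comp_rt rt_m3.
  split.
    under eq_bigr => v _ do rewrite /d !mulrDr !mulrA.
    rewrite !big_split /= (sum_delta _ (fun v => s v * - (k * d0 a))).
    rewrite (sum_delta _ (fun v => s v * o3 p)) (sum_delta _ (fun v => s v * o3 (m3 p))).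
    by rewrite pa qa; case: (a \in comp r); rewrite ?mulr0 // !mulr1 -[RHS]kE; ring.
  apply: (@le_trans _ _ (\sum_(v in comp r) (2 * (v == a)%:R + 1 * (v == p)%:R
    + 1 * (v == m3 p)%:R))).
    apply: ler_sum => v _; rewrite /d.
    by case: (v == a); case: (v == p); case: (v == m3 p); case: sk => ->;
       case: (os3 p) => ->; case: (os3 (m3 p)) => ->; lia.
  rewrite !big_split /= (sum_delta _ (fun=> 2)) (sum_delta _ (fun=> 1)).
  by rewrite (sum_delta _ (fun=> 1)) pa qa; case: (a \in _).
have := sol_add (sol_add sF (sol_scale k sG)) (sol_link m1 m2 o1 o2 o3 mm3 p 1).
case=> i _ e.
eexists; eexists; eexists; split; first split.
- exact: i.
- by move=> v; rewrite inE.
- move=> v; rewrite -[RHS](e v); congr (_ + _).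
  rewrite /d in_set2; have [->|va] := eqVneq v a.
    case: (eqVneq a p) => [->|ne]; first by rewrite eq_sym (negbTE qp) /=; ring.
    by case: eqP => [->|_] /=; ring.
  rewrite (d00 v va); case: (eqVneq v p) => [->|ne]; first by rewrite eq_sym (negbTE qp) /=; ring.
  by case: eqP => [->|_] /=; ring.
- move=> v vC /=; have [-> ->] := F0 v vC; rewrite !add0r !addr0 !normrM sgn_norm //.
  by have [-> ->] := bG v vC.
- move=> v vC /=; have [_ G0 _] := sG; have [-> -> _] := G0 v vC.
  by rewrite mulr0 !addr0; apply: bF.
- by move=> v /=; have := b3 v; rewrite mulr0 addr0; case: ifP => _; lia.
Qed.

(* If no two positions of C0 were joined by a chord inconsistent with the cut after
   position m, then g would switch the graph to one whose only negative edge is the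
   one following position m, and the nowhere-zero flow would vanish there. *)
Lemma chord_flow s G1 G2 G3 : (forall v, sgn (s v)) -> potential (~: C0) s ->
  (forall d, (forall r, \sum_(v in comp r) s v * d v = 0 /\
                       \sum_(v in comp r) `|d v| <= 4) ->
    exists F1 F2 F3, [/\ sol setT d F1 F2 F3,
      forall v, v \in C0 -> F1 v = 0 /\ F2 v = 0,
      forall v, `|F1 v| <= 1 /\ `|F2 v| <= 1 & forall v, `|F3 v| <= 2]) ->
  (forall p, s p * o3 p + s (m3 p) * o3 (m3 p) = 0) ->
  hflow m1 m2 m3 o1 o2 o3 G1 G2 G3 -> (forall v, G1 v != 0 /\ G2 v != 0) ->
  unbalanced_profile.
Proof.
move=> ss pot solve cons3 [[iG1 iG2 iG3] _ eG] nzG.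
have [n cw] := walk_circuit mm1 mm2 x; move: (walk _ _ _) cw => w cw.
have [/andP[n0 evn] _ _ _ _] := cw.
have [u [us uS un]] := walk_potential os1 os2 cw.
have {un} un : u n.-1 * outer o1 o2 w n.-1 = u 0%N * inner o1 o2 w 0%N.
  rewrite un (_ : \prod_(v in C0) _ = -1) ?mulN1r ?opprK // -[RHS]unbx.
  by apply: eq_bigr => v _; rewrite /sg inE mulr1.
have os : forall k, sgn (outer o1 o2 w k) by move=> k; apply: outer_sgn.
(* [u] switches the circuit so that only its closing edge is negative; [a] compares the potential of
   the component with this switching. *)
pose cl k := rt (w k); pose a k := s (w k) * u k.
have sa k : sgn (a k) by apply: sgnM.
have admissible m : (m < n)%N -> exists P : chord n, valid cl P &&
    (if same a P then (P.1 <= m < P.2)%N else ~~ (P.1 <= m < P.2)%N).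
  move=> mn; set good := fun P : chord n => valid cl P &&
    (if same a P then (P.1 <= m < P.2)%N else ~~ (P.1 <= m < P.2)%N).
  have [/existsP//|/existsPn none] := boolP [exists P, good P].
  (* Reversing the switching after position [m] moves the negative edge from the closing position to
     [m]. *)
  pose e k : int := if (k <= m)%N then 1 else -1.
  have se k : sgn (e k) by rewrite /e; case: ifP; [left|right].
  have ae_lt i j : (i < j)%N -> (j < n)%N -> cl i = cl j -> a i * e i = a j * e j.
    move=> ij jn cij; have iN := ltn_trans ij jn.
    have := none (Ordinal iN, Ordinal jn); rewrite /good /valid /same /= ij cij eqxx /=.
    rewrite /e; case: eqP => [->|ne].
      rewrite negb_and => h; congr (_ * _).
      by case: (leqP i m) h => h1; case: (leqP j m) => h2 //=; lia.
    rewrite negbK => /andP[-> mj]; rewrite leqNgt mj /=.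
    by case: (sa i) ne => ->; case: (sa j) => ->.
  have ae i j : (i < n)%N -> (j < n)%N -> cl i = cl j -> a i * e i = a j * e j.
    case: (ltngtP i j) => [ij|ji|-> //] iN jN cij; first exact: ae_lt.
    by apply/esym/ae_lt.
  (* One sign per component, read off at any of its vertices on the circuit; the absence of a
     suitable chord makes it independent of that vertex. *)
  pose tau v : int := if [pick k : 'I_n | cl k == rt v] is Some k then a k * e k else 1.
  have tauE k : (k < n)%N -> s (w k) * tau (w k) = u k * e k.
    move=> kn; rewrite /tau; case: pickP => [j /eqP clj|/(_ (Ordinal kn))]; last first.
      by rewrite eqxx.
    by rewrite (ae j k) // /a; case: (ss (w k)) => ->; ring.
  have tau3 v : tau (m3 v) = tau v by rewrite /tau rt_m3.
  have tau12 v : v \notin C0 -> tau (m1 v) = tau v /\ tau (m2 v) = tau v.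
    by move=> vC; rewrite /tau; have [-> ->] := rt_m12 vC.
  pose g v := s v * tau v.
  (* After switching by [g] all edges off the circuit are positive, so they cancel out of the sum of
     the vertex equations. *)
  have : \sum_(v in C0) g v * (o1 v * G1 v + o2 v * G2 v) = 0.
    have T3 : \sum_(v in [set: V]) g v * (o3 v * G3 v) = 0.
      apply: (matching_sum mm3) => v _; rewrite ?inE // /g tau3 iG3.
      by have := cons3 v; case: (ss v) => ->; case: (ss (m3 v)) => ->;
         case: (os3 v) => ->; case: (os3 (m3 v)) => -> // _; ring.
    have T1 : \sum_(v in ~: C0) g v * (o1 v * G1 v) = 0.
      apply: (matching_sum mm1) => v; rewrite !in_setC ?orb_m1 // => vC.
      have [e1 _] := pot v (etrans (in_setC _ _) vC); have [t1 _] := tau12 v vC.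
      rewrite /g iG1 t1 !mulrA [s (m1 v) * _ * _]mulrAC e1; ring.
    have T2 : \sum_(v in ~: C0) g v * (o2 v * G2 v) = 0.
      apply: (matching_sum mm2) => v; rewrite !in_setC ?orb_m2 // => vC.
      have [_ e1] := pot v (etrans (in_setC _ _) vC); have [_ t2] := tau12 v vC.
      rewrite /g iG2 t2 !mulrA [s (m2 v) * _ * _]mulrAC e1; ring.
    have : \sum_(v in [set: V]) g v * (o1 v * G1 v + o2 v * G2 v + o3 v * G3 v) = 0.
      by rewrite big1 // => v _; have := eG v; rewrite addr0 => ->; rewrite mulr0.
    under eq_bigr => v _ do rewrite mulrDr.
    rewrite big_split /= T3 addr0 -(setUCr C0) sum_setU; last first.
      by rewrite disjoints_subset setCK.
    rewrite [X in _ + X](_ : _ = 0) ?addr0 //.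
    under eq_bigr => v _ do rewrite mulrDr.
    by rewrite big_split /= T1 T2.
  have kap k : (k < n)%N -> g (w k) * outer o1 o2 w k +
      g (w (nxt n k)) * inner o1 o2 w (nxt n k) =
      if k == m then 2 * (u k * outer o1 o2 w k) else 0.
    move=> kn; rewrite /g !tauE ?nxt_ltn // /nxt.
    case: (eqVneq k.+1 n) => [ekn|ne].
      have kE : k = n.-1 by lia.
      have -> : e 0%N = 1 by [].
      rewrite mulr1 -un -kE /e; case: eqP => [->|km]; first by rewrite leqnn; ring.
      have -> : (k <= m)%N = false by lia.
      ring.
    rewrite [u k.+1 * e k.+1]mulrC -[_ * inner _ _ _ _]mulrA.
    have -> : u k.+1 * inner o1 o2 w k.+1 = - (u k * outer o1 o2 w k) by rewrite uS opprK.
    rewrite /e; case: eqP => [->|km]; first by rewrite leqnn ltnn; ring.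
    have -> : (k < m)%N = (k <= m)%N by lia.
    by case: leq; ring.
  rewrite (circuit_sum mm1 mm2 o1 o2 g cw iG1 iG2) (bigD1 (Ordinal mn)) //=.
  rewrite kap // eqxx big1 => [|k km]; last first.
    rewrite kap //; case: eqP => [e1|]; last by rewrite mulr0.
    by move/negP: km; case; apply/eqP/val_inj.
  have : (if odd m then G2 (w m) else G1 (w m)) != 0.
    by have [? ?] := nzG (w m); case: ifP.
  by case: (us m) => ->; case: (os m) => ->; lia.
have [Z [bZ prof]] := balanced_profile_exists n0 sa admissible.
pose X k := u k * outer o1 o2 w k * Z k.
have [F1 [F2 [i1 i2 F0 FX]]] := circuit_values mm1 mm2 X cw.
(* The components have to absorb the imbalance of the circuit; by [dE] it is the drop of the
   profile, up to the switching. *)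
pose d v := if v \in C0 then o1 v * F1 v + o2 v * F2 v else 0.
have dE k : (k < n)%N -> d (w k) = - (u k * drops n Z k).
  move=> kn; have kC : w k \in C0 by apply/(circuit_mem _ cw); exists k.
  have [e1 e2] := FX k kn; rewrite /d kC e1 e2.
  have -> : o1 (w k) * X (if odd k then prv n k else k) +
            o2 (w k) * X (if odd k then k else prv n k) =
            outer o1 o2 w k * X k + inner o1 o2 w k * X (prv n k).
    by rewrite /outer /inner; case: (odd k); rewrite // addrC.
  rewrite /X /drops /prv; case: (eqVneq k 0%N) => [->|k0].
    rewrite un; case: (os 0%N) => ->; case: (inner_sgn os1 os2 w 0%N) => ->; ring.
  have := uS k.-1; rewrite prednK ?lt0n // => ->.
  case: (os k) => ->; case: (inner_sgn os1 os2 w k) => ->; ring.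
have [r|K1 [K2 [K3 [sK K0 bK b3]]]] := solve d.
  have conv (h : V -> int) : (forall v, v \notin C0 -> h v = 0) ->
      \sum_(v in comp r) h v = \sum_(k < n | cl k == rt r) h (w k).
    move=> h0; rewrite big_mkcond [RHS]big_mkcond /=.
    transitivity (\sum_(v in C0) if v \in comp r then h v else 0).
      rewrite [RHS]big_mkcond /=; apply: eq_bigr => v _.
      by case: (boolP (v \in C0)) => // /h0 ->; case: ifP.
    rewrite (circuit_big _ _ cw); apply: eq_bigr => k _.
    by rewrite comp_rt.
  have d0 v : v \notin C0 -> d v = 0 by rewrite /d => /negbTE ->.
  have [sum0 sum4] := prof (rt r).
  split; rewrite conv => [|v /d0 ->]; rewrite ?mulr0 ?normr0 //.
    under eq_bigr => k _ do rewrite dE // mulrN mulrA.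
    by rewrite sumrN sum0 oppr0.
  apply: le_trans sum4; apply: ler_sum => k _.
  by rewrite dE // normrN normrM (sgn_norm (us k)) mul1r lexx.
have Xb k : (k < n)%N -> 1 <= `|X k| <= 3.
  by move=> kn; rewrite /X !normrM (sgn_norm (us k)) (sgn_norm (os k)) !mul1r; apply: bZ.
have [[j1 j2 j3] _ eK] := sK.
exists (fun v => F1 v + K1 v), (fun v => F2 v + K2 v), K3; split.
- split=> [|v|v]; [by split=> v; rewrite ?i1 ?i2 ?j1 ?j2 ?j3|by rewrite inE|].
  rewrite addr0 -[RHS](eK v) /d; case: ifP => [_|/negbT/F0[-> ->]]; ring.
- move=> v /[dup] vC /(circuit_mem _ cw)[k kn vk]; have [-> ->] := K0 v vC.
  have [pk _ _] := prvP kn evn; rewrite !addr0 vk; have [-> ->] := FX k kn.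
  by split; case: ifP => _; apply: Xb.
- by move=> v /F0[-> ->]; rewrite !add0r; apply: bK.
- by move=> v; apply: le_trans (b3 v) _.
Qed.

(** Either some edge of the third color contradicts the potential, which gives the barbell, or every
    component is balanced and chords can be used. *)
Lemma unbalanced_profile_exists G1 G2 G3 : hflow m1 m2 m3 o1 o2 o3 G1 G2 G3 ->
  (forall v, G1 v != 0 /\ G2 v != 0) -> unbalanced_profile.
Proof.
move=> hG nzG; have [s [ss pot solve]] := demand_flow.
have [/existsP[p hp]|/existsPn cons] :=
    boolP [exists p, s p * o3 p + s (m3 p) * o3 (m3 p) != 0].
  exact: barbell_flow hp.
apply: (chord_flow ss pot solve _ hG nzG) => p.
by have := cons p; rewrite negbK => /eqP.
Qed.
End OneUnbalanced.

(** * Combining the flows *)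

Definition nz_flow (V : finType) (ma mb mc : V -> V) (oa ob oc : V -> int) (k : int) :=
  exists Fa Fb Fc, hflow ma mb mc oa ob oc Fa Fb Fc /\
    forall v, [/\ 1 <= `|Fa v| <= k, 1 <= `|Fb v| <= k & 1 <= `|Fc v| <= k].

Section HalfEdgeFlows.
Variables (V : finType) (ma mb mc : V -> V) (oa ob oc : V -> int).

Lemma hflow_rot Fa Fb Fc : hflow ma mb mc oa ob oc Fa Fb Fc ->
  hflow mb mc ma ob oc oa Fb Fc Fa.
Proof.
move=> [[? ? ?] _ e]; split=> // v; first by rewrite inE.
by rewrite -[RHS](e v); ring.
Qed.

Lemma hflow_swap Fa Fb Fc : hflow ma mb mc oa ob oc Fa Fb Fc ->
  hflow mb ma mc ob oa oc Fb Fa Fc.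
Proof.
move=> [[? ? ?] _ e]; split=> // v; first by rewrite inE.
by rewrite -[RHS](e v); ring.
Qed.

Lemma nz_flow_swap k : nz_flow ma mb mc oa ob oc k -> nz_flow mb ma mc ob oa oc k.
Proof.
move=> [Fa [Fb [Fc [hF bF]]]]; exists Fb, Fa, Fc; split; first exact: hflow_swap.
by move=> v; have [? ? ?] := bF v.
Qed.

Lemma hflow_comb x y Fa Fb Fc Ga Gb Gc :
  hflow ma mb mc oa ob oc Fa Fb Fc -> hflow ma mb mc oa ob oc Ga Gb Gc ->
  hflow ma mb mc oa ob oc (fun v => x * Fa v + y * Ga v)
    (fun v => x * Fb v + y * Gb v) (fun v => x * Fc v + y * Gc v).
Proof.
move=> hF hG; have [i _ e] := sol_add (sol_scale x hF) (sol_scale y hG).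
split=> // v; first by rewrite inE.
by have := e v; rewrite !mulr0.
Qed.

Lemma linked_rot : linked ma mb mc -> linked mb mc ma.
Proof. by move=> h A v vA clA; apply: (h A v vA) => w /clA[]. Qed.

Lemma linked_swap : linked ma mb mc -> linked mb ma mc.
Proof. by move=> h A v vA clA; apply: (h A v vA) => w /clA[]. Qed.
End HalfEdgeFlows.

Lemma hflow_swap23 (V : finType) (ma mb mc : V -> V) (oa ob oc Fa Fb Fc : V -> int) :
  hflow ma mc mb oa oc ob Fa Fc Fb -> hflow ma mb mc oa ob oc Fa Fb Fc.
Proof. by move/hflow_rot/hflow_rot/hflow_swap. Qed.

Lemma linked_swap23 (V : finType) (ma mb mc : V -> V) :
  linked ma mb mc -> linked ma mc mb.
Proof. by move/linked_rot/linked_rot/linked_swap. Qed.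

Section ThreeMatchings.
Variables (V : finType) (ma mb mc : V -> V) (oa ob oc : V -> int).
Hypotheses (mma : matching ma) (mmb : matching mb) (mmc : matching mc).
Hypotheses (osa : forall v, sgn (oa v)) (osb : forall v, sgn (ob v))
  (osc : forall v, sgn (oc v)).
Hypothesis conn : linked ma mb mc.

Local Notation hflow := (hflow ma mb mc oa ob oc).
Local Notation nz_flow := (nz_flow ma mb mc oa ob oc).

Lemma nz8_even (r : V) : parity oa ob setT set0 = 1 -> parity oa oc setT set0 = 1 ->
  nz_flow 7.
Proof.
move=> pab pac.
have [Fa [Fb [Fc [hF bF bc]]]] := even_flow mma mmb mmc osa osb osc conn r pab.
have [Ga [Gc [Gb [/hflow_swap23 hG bG bb]]]] :=
  even_flow mma mmc mmb osa osc osb (linked_swap23 conn) r pac.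
exists (fun v => 1 * Fa v + 3 * Ga v), (fun v => 1 * Fb v + 3 * Gb v),
  (fun v => 1 * Fc v + 3 * Gc v); split; first exact: hflow_comb.
(* On the second color the sum is +-1 plus a multiple of 3 of size at most 6; on the third it is +-3
   plus at most 2; on the first, +-1 +-3. *)
move=> v; have [fa fb] := bF v; have [ga gc] := bG v; have := bc v; have := bb v.
by split; lia.
Qed.

Lemma nz8_unique x : (forall v, parity oa ob (orb ma mb v) set0 = 1) ->
  parity oa oc (orb ma mc x) set0 = -1 ->
  (forall v, v \notin orb ma mc x -> parity oa oc (orb ma mc v) set0 = 1) ->
  (exists Ga Gb Gc, hflow Ga Gb Gc /\ forall v, [/\ Ga v != 0, Gb v != 0 & Gc v != 0]) ->
  nz_flow 7.
Proof.
move=> balab unbx balac [Na [Nb [Nc [hN nzN]]]].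
have [|Fa [Fb [hF bF]]] := balanced_flow mc oc mma mmb osa osb (T := setT).
  by move=> v _; rewrite !inE.
have [|Ga [Gc [sG bG]]] := balanced_flow mb ob mma mmc osa osc (T := ~: orb ma mc x).
  by move=> v; rewrite !in_setC orb_m1 // orb_m2 // => vC; split=> //; apply: balac.
have hG : hflow Ga (fun=> 0) Gc.
  by apply: hflow_swap23; case: sG => i _ e; split=> // v; rewrite inE.
have nzN' v : Na v != 0 /\ Nc v != 0 by have [] := nzN v.
have [Ha [Hc [Hb [/hflow_swap23 hH onC offC bb]]]] :=
  unbalanced_profile_exists mma mmc mmb osa osc osb unbx balac (linked_swap23 conn)
    (hflow_swap23 hN) nzN'.
exists (fun v => 4 * Fa v + 1 * (2 * Ga v + 1 * Ha v)),
  (fun v => 4 * Fb v + 1 * (2 * 0 + 1 * Hb v)), (fun v => 4 * 0 + 1 * (2 * Gc v + 1 * Hc v)).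
split; first by apply: hflow_comb => //; apply: hflow_comb.
move=> v; have [fa fb] := bF v (in_setT v); have hb := bb v.
have [vC|vC] := boolP (v \in orb ma mc x).
  have [ha hc] := onC v vC; have [_ G0 _] := sG.
  have [|ga gc _] := G0 v; first by rewrite in_setC vC.
  by rewrite ga gc; split; lia.
have [ha hc] := offC v vC; have [|ga gc] := bG v; first by rewrite in_setC.
by split; lia.
Qed.

Lemma nz10_many x y : (forall v, parity oa ob (orb ma mb v) set0 = 1) ->
  parity oa oc (orb ma mc x) set0 = -1 -> parity oa oc (orb ma mc y) set0 = -1 ->
  y \notin orb ma mc x -> parity oa oc setT set0 = -1 -> nz_flow 9.
Proof.
move=> balab ux uy yx pac.
have [|Fa [Fb [hF bF]]] := balanced_flow mc oc mma mmb osa osb (T := setT).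
  by move=> v _; rewrite !inE.
have [Ga [Gc [Gb [/hflow_swap23 hG bG bb]]]] :=
  odd_flow mma mmc mmb osa osc osb (linked_swap23 conn) ux uy yx pac.
exists (fun v => 5 * Fa v + 1 * Ga v), (fun v => 5 * Fb v + 1 * Gb v),
  (fun v => 5 * 0 + 1 * Gc v); split; first exact: hflow_comb.
move=> v; have [fa fb] := bF v (in_setT v); have [ga gc] := bG v; have := bb v.
by split; lia.
Qed.
End ThreeMatchings.

Section Exchange.
Variables (V : finType) (ma mb mc : V -> V) (oa ob oc : V -> int).
Hypotheses (mma : matching ma) (mmb : matching mb) (mmc : matching mc).
Hypotheses (osa : forall v, sgn (oa v)) (osb : forall v, sgn (ob v))
  (osc : forall v, sgn (oc v)).
Hypothesis conn : linked ma mb mc.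

(* Exchanging the first two colors on an unbalanced circuit formed by them
   changes the parity of each, which reduces the claim to [nz8_even]. *)
Lemma nz8_exchange x : parity oa ob (orb ma mb x) set0 = -1 ->
  parity oa ob setT set0 = 1 -> parity oa oc setT set0 = -1 ->
  nz_flow ma mb mc oa ob oc 7.
Proof.
set D := orb ma mb x => parD pab pac.
have Da v : (ma v \in D) = (v \in D) by rewrite orb_m1.
have Db v : (mb v \in D) = (v \in D) by rewrite orb_m2.
move: D parD Da Db => D parD Da Db {x}.
pose ex T (f g : V -> T) v := if v \in D then g v else f v.
have mex f g : matching f -> matching g -> (forall v, (f v \in D) = (v \in D)) ->
    (forall v, (g v \in D) = (v \in D)) -> matching (ex V f g).
  move=> [Kf Nf] [Kg Ng] fD gD; split=> v; rewrite /ex.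
    by case: (boolP (v \in D)) => vD; rewrite ?gD ?fD ?vD ?(negbTE vD).
  by case: ifP.
have sex f g : (forall v, sgn (f v)) -> (forall v, sgn (g v)) ->
    forall v, sgn (ex int f g v).
  by move=> sf sg v; rewrite /ex; case: ifP.
have conn' : linked (ex V ma mb) (ex V mb ma) mc.
  move=> A v vA clA; apply: (conn vA) => w wA; have [] := clA w wA.
  by rewrite /ex; case: ifP.
have par_split (o : V -> int) : parity o oc setT set0 =
    parity o oc D set0 * parity o oc (~: D) set0.
  by rewrite -(setUCr D) parityU // disjoints_subset setCK.
have pab' : parity (ex int oa ob) (ex int ob oa) setT set0 = 1.
  rewrite -[RHS]pab; apply: eq_bigr => v _; rewrite /ex.
  by case: ifP => // _; rewrite [ob v * _]mulrC.
have pac' : parity (ex int oa ob) oc setT set0 = 1.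
  have eD : parity (ex int oa ob) oc D set0 = parity ob oc D set0.
    by apply: eq_bigr => v vD; rewrite /ex vD.
  have eC : parity (ex int oa ob) oc (~: D) set0 = parity oa oc (~: D) set0.
    by apply: eq_bigr => v; rewrite in_setC => /negbTE vD; rewrite /ex vD.
  have eM : parity ob oc D set0 * parity oa oc D set0 = -1.
    rewrite -[RHS]parD /parity -big_split; apply: eq_bigr => v _ /=.
    by rewrite /sg inE; case: (osc v) => ->; ring.
  rewrite par_split eD eC; move: pac eM; rewrite par_split.
  case: (parity_sgn osb osc D set0) => ->; case: (parity_sgn osa osc D set0) => ->;
  by case: (parity_sgn osa osc (~: D) set0) => ->.
have [V0|[r _]] := set_0Vmem [set: V].
  by move: pac; rewrite V0 /parity big_set0.
have [Fa [Fb [Fc [[[ia ib ic] _ e] bF]]]] := nz8_even (mex _ _ mma mmb Da Db)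
  (mex _ _ mmb mma Db Da) mmc (sex _ _ osa osb) (sex _ _ osb osa) osc conn' r pab' pac'.
exists (ex int Fa Fb), (ex int Fb Fa), Fc; split; last first.
  by move=> v; have [? ? ?] := bF v; rewrite /ex; case: ifP.
split=> [|v|v]; [split=> // v| |]; rewrite ?inE //.
- by have := ia v; have := ib v; rewrite /ex Da; case: ifP.
- by have := ia v; have := ib v; rewrite /ex Db; case: ifP.
- by have := e v; rewrite /ex; case: ifP => _ h //; rewrite -[RHS]h; ring.
Qed.

(** The statement treats the first two colors asymmetrically. The theorem applies it twice, with
    these colors exchanged; only if both applications miss the bound 7 are all conditions of the
    exceptional case at hand. *)
Lemma nz8_or_nz10 : parity oa ob setT set0 = 1 ->
  (exists Ga Gb Gc, hflow ma mb mc oa ob oc Ga Gb Gc /\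
     forall v, [/\ Ga v != 0, Gb v != 0 & Gc v != 0]) ->
  nz_flow ma mb mc oa ob oc 7 \/
  [/\ nz_flow ma mb mc oa ob oc 9, forall v, parity oa ob (orb ma mb v) set0 = 1,
    parity oa oc setT set0 = -1 & exists x y, [/\ parity oa oc (orb ma mc x) set0 = -1,
      parity oa oc (orb ma mc y) set0 = -1 & y \notin orb ma mc x]].
Proof.
move=> pab adm.
have [V0|[r _]] := set_0Vmem [set: V].
  left; exists (fun=> 0), (fun=> 0), (fun=> 0).
  by split=> [|v]; [split=> // v; rewrite ?inE // !mulr0|have := in_setT v; rewrite V0 inE].
case: (parity_sgn osa osc setT set0) => pac.
  by left; exact: (nz8_even mma mmb mmc osa osb osc conn r pab pac).
have [/existsP[x /eqP ux]|/existsPn bal] :=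
    boolP [exists x, parity oa ob (orb ma mb x) set0 == -1].
  by left; apply: (nz8_exchange ux).
have balab v : parity oa ob (orb ma mb v) set0 = 1.
  by have := bal v; case: (parity_sgn osa osb (orb ma mb v) set0) => ->.
have [x ux] : exists x, parity oa oc (orb ma mc x) set0 = -1.
  have [/existsP[x /eqP ux]|/existsPn balac] :=
    boolP [exists x, parity oa oc (orb ma mc x) set0 == -1]; first by exists x.
  suff : parity oa oc setT set0 = 1 by rewrite pac.
  apply: (parity_balanced mb ob mma mmc osa osc) => v _; rewrite !inE; split=> //.
  by have := balac v; case: (parity_sgn osa osc (orb ma mc v) set0) => ->.
have [/existsP[y /andP[/eqP uy yx]]|/existsPn uniq] :=
    boolP [exists y, (parity oa oc (orb ma mc y) set0 == -1) && (y \notin orb ma mc x)].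
  right; split=> //; last by exists x, y.
  exact: (nz10_many mma mmb mmc osa osb osc conn balab ux uy yx pac).
left; apply: (nz8_unique mma mmb mmc osa osb osc conn balab ux _ adm) => v vx.
have := uniq v; rewrite vx andbT.
by case: (parity_sgn osa osc (orb ma mc v) set0) => ->.
Qed.
End Exchange.

(** * Cubic graphs as triples of matchings *)

Section ColoredGraph.
Variables (G : mgraph) (sigma : edge G -> int) (c : edge G -> 'I_3).
Hypotheses (hsigma : signature sigma) (hcubic : cubic G)
  (hc : proper_edge_coloring c).

Local Notation V := (vert G).
Implicit Types (h : Defs.half G) (e : edge G) (v w : V) (i j k : 'I_3) (S O : {set V}).

Lemma half_uniq h h' : inc h = inc h' -> c h.1 = c h'.1 -> h = h'.
Proof. by move=> ei ec; have [//|/hc/(_ ei)] := eqVneq h h'; rewrite ec eqxx. Qed.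

Lemma half_exists : exists hf : 'I_3 -> V -> Defs.half G,
  forall k v, inc (hf k v) = v /\ c (hf k v).1 = k.
Proof.
have ex k v : exists h, inc h = v /\ c h.1 = k.
  pose A := half_at v; pose f h := c h.1.
  have finj : {in A &, injective f}.
    by move=> h h'; rewrite !inE => /eqP e /eqP e'; apply: half_uniq; rewrite e e'.
  have : k \in f @: A.
    suff -> : f @: A = setT by rewrite inE.
    by apply/eqP; rewrite eqEcard subsetT cardsT card_ord card_in_imset // hcubic.
  by case/imsetP => h; rewrite inE => /eqP e ->; exists h.
have [hf hfP] := fin_all_exists (fun k => fin_all_exists (ex k)).
by exists hf.
Qed.

Variable hf : 'I_3 -> V -> Defs.half G.
Hypothesis hfP : forall k v, inc (hf k v) = v /\ c (hf k v).1 = k.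

Definition opp h : Defs.half G := (h.1, ~~ h.2).
Definition mu k v := inc (opp (hf k v)).
(** A reference orientation: + on one half of each edge, and on the other half what the signature
    then forces. *)
Definition tau0 h : int := if h.2 then - sigma h.1 else 1.
Definition ori k v : int := tau0 (hf k v).

Lemma hf_eq h : hf (c h.1) (inc h) = h.
Proof. by apply: half_uniq; have [] := hfP (c h.1) (inc h). Qed.

Lemma hf_mu k v : hf k (mu k v) = opp (hf k v).
Proof.
have [_ e] := hfP k v; rewrite -[RHS]hf_eq; congr (hf _ _).
by rewrite /opp /= e.
Qed.

Lemma mu_matching k : matching (mu k).
Proof.
split=> v.
  rewrite {1}/mu hf_mu /opp /= negbK -surjective_pairing.
  by have [] := hfP k v.
apply/eqP => e; have : hf k v = opp (hf k v) by rewrite -hf_mu e.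
by case: (hf k v) => x [].
Qed.

Lemma sigma_sgn e : sgn (sigma e).
Proof. by case/orP: (hsigma e) => /eqP; [left|right]. Qed.

Lemma tau0_sgn h : sgn (tau0 h).
Proof. by rewrite /tau0; case: ifP => _; [apply/sgnN/sigma_sgn|left]. Qed.

Lemma ori_sgn k v : sgn (ori k v). Proof. exact: tau0_sgn. Qed.

Lemma mu_ends e b : mu (c e) (ends e b) = ends e (~~ b).
Proof. by rewrite /mu -[ends e b]/(inc (e, b)) -[c e]/(c (e, b).1) hf_eq. Qed.

Lemma half_sum (g : Defs.half G -> int) v :
  \sum_(h in half_at v) g h = \sum_k g (hf k v).
Proof.
have -> : half_at v = [set hf k v | k : 'I_3].
  apply/setP => h; rewrite inE; apply/eqP/imsetP => [<-|[k _ ->]].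
    by exists (c h.1); rewrite ?hf_eq.
  by have [] := hfP k v.
rewrite big_imset //= => k k' _ _ e.
by have [_ <-] := hfP k v; have [_ <-] := hfP k' v; rewrite e.
Qed.

Definition c0 := @Ordinal 3 0 isT.
Definition c1 := @Ordinal 3 1 isT.
Definition c2 := @Ordinal 3 2 isT.

Lemma sum3 (g : 'I_3 -> int) : \sum_k g k = g c0 + g c1 + g c2.
Proof.
rewrite !big_ord_recl big_ord0 addr0 addrA.
by congr (g _ + g _ + g _); apply: val_inj.
Qed.

Lemma color_cases (P : 'I_3 -> Prop) : P c0 -> P c1 -> P c2 -> forall k, P k.
Proof.
by move=> P0 P1 P2 [[|[|[|//]]] lt]; rewrite (bool_irrelevance lt isT).
Qed.

Lemma nz_flow_graph (k : nat) :
  nz_flow (mu c0) (mu c1) (mu c2) (ori c0) (ori c1) (ori c2) k%:Z ->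
  has_nowhere_zero_flow sigma k.+1.
Proof.
move=> [F0 [F1 [F2 [[[i0 i1 i2] _ e] bF]]]].
pose F (k : 'I_3) v := if k == c0 then F0 v else if k == c1 then F1 v else F2 v.
have iF j v : F j (mu j v) = F j v by move: j; apply: color_cases; rewrite /F /=.
pose f e := F (c e) (ends e false).
have fE h : f h.1 = F (c h.1) (inc h).
  by case: h => x [] //=; rewrite /f -iF mu_ends.
have bf x : 1 <= `|f x| <= k.
  rewrite /f; have [? ? ?] := bF (ends x false); rewrite /F.
  by case: eqP => // _; case: eqP.
exists tau0, f; split; last by move=> x; have := bf x; lia.
split=> [|x|v].
- split=> [h|x]; last by rewrite /tau0 /= mul1r.
  by rewrite /is_sign; case: (tau0_sgn h) => ->.
- by have := bf x; lia.
rewrite half_sum -[RHS](e v) addr0 -[RHS](sum3 (fun k => ori k v * F k v)).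
by apply: eq_bigr => j _; rewrite fE; have [-> ->] := hfP j v.
Qed.

Lemma admissible_half_flow : flow_admissible sigma ->
  exists F0 F1 F2, hflow (mu c0) (mu c1) (mu c2) (ori c0) (ori c1) (ori c2) F0 F1 F2 /\
    forall v, [/\ F0 v != 0, F1 v != 0 & F2 v != 0].
Proof.
move=> [n _ [tau [f [[[st tt] _ ef] nzf]]]].
(* Passing from [tau] to the reference orientation reverses the value of an edge whenever [tau] is
   -1 on its first half. *)
pose f' e := f e * tau (e, false); pose F k v := f' (hf k v).1.
have iF k v : F k (mu k v) = F k v by rewrite /F hf_mu.
have st' h : sgn (tau h) by case/orP: (st h) => /eqP; [left|right].
have nzF k v : F k v != 0.
  by rewrite /F /f' mulf_neq0 //; case: (st' ((hf k v).1, false)) => ->.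
exists (F c0), (F c1), (F c2); split=> [|v]; last by split; apply: nzF.
split=> [|v|v]; [by split|by rewrite inE|].
rewrite addr0 -(sum3 (fun k => ori k v * F k v)) -[RHS](ef v) half_sum.
apply: eq_bigr => k _; rewrite /ori /F /f' /tau0.
case: (hf k v) => x [] /=; last by rewrite mul1r mulrC.
have := tt x; rewrite -[X in _ = X](opprK) => /(congr1 -%R); rewrite !opprK => <-.
by case: (st' (x, false)) => ->; ring.
Qed.

Lemma mu_linked : connected G -> linked (mu c0) (mu c1) (mu c2).
Proof.
move=> [_ conn] A v vA clA; apply/setP => w; rewrite inE.
have clk k u : u \in A -> mu k u \in A.
  by move=> /clA[? ? ?]; move: k; apply: color_cases.
case/connectP: (conn v w) => p; elim: p v vA => [|x p IH] v vA /= => [_ -> //|].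
case/andP => /exists_inP[e _ /existsP[b /andP[/eqP ev /eqP ex]]] px e'.
by apply: (IH x) => //; rewrite -ex -mu_ends ev; apply: clk.
Qed.

(** For [S] closed under [mu k] both ends of such an edge lie in [S]; testing one of them
    suffices. *)
Definition class_in k S : {set edge G} := [set e | (c e == k) && (ends e false \in S)].

Lemma class_big (R : Type) (idx : R) (op : Monoid.com_law idx) (g : Defs.half G -> R) k S :
  (forall v, v \in S -> mu k v \in S) ->
  \big[op/idx]_(v in S) g (hf k v) =
  \big[op/idx]_(e in class_in k S) op (g (e, false)) (g (e, true)).
Proof.
move=> clS.
have endS e b : c e = k -> (ends e b \in S) = (ends e false \in S).
  move=> ce; case: b => //; apply/idP/idP => /clS; by rewrite -ce mu_ends.
have inj : {in S &, injective (hf k)}.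
  by move=> v w _ _ e; have [<- _] := hfP k v; have [<- _] := hfP k w; rewrite e.
rewrite -(big_imset _ inj) /=.
transitivity (\big[op/idx]_(e in class_in k S) \big[op/idx]_(b : bool) g (e, b)).
  rewrite pair_big /=; apply: eq_big => [[e b]|[e b] _] //.
  rewrite inE /= andbT; apply/imsetP/andP => [[v vS e']|[/eqP ce eS]].
    have [ei ek] := hfP k v; rewrite -e' /= in ei ek; rewrite ek eqxx; split=> //.
    by rewrite -(endS e b) // -[ends e b]/(inc (e, b)) ei.
  exists (inc (e, b)); first by rewrite /inc /= endS.
  by rewrite -ce -[c e]/(c (e, b).1) hf_eq.
by apply: eq_bigr => e _; rewrite big_bool Monoid.mulmC.
Qed.

Lemma class_in_card k S : (forall v, v \in S -> mu k v \in S) ->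
  #|S| = (#|class_in k S| * 2)%N.
Proof.
move=> clS; rewrite -sum1_card (class_big _ (fun=> 1%N) clS).
by rewrite sum_nat_const.
Qed.

(** Each edge contributes $-\sigma(e)$. Both colors have |S|/2 edges in [S], so the factors -1
    cancel in pairs and only the negative edges count. *)
Lemma parity_odd i j S : i != j -> (forall v, v \in S -> mu i v \in S /\ mu j v \in S) ->
  parity (ori i) (ori j) S set0 =
    (-1) ^+ odd #|(class_in i S :|: class_in j S) :&: neg_edges sigma|.
Proof.
move=> ij clS; have cli v : v \in S -> mu i v \in S by case/clS.
have clj v : v \in S -> mu j v \in S by case/clS.
have prodE k : (forall v, v \in S -> mu k v \in S) ->
    \prod_(v in S) ori k v =
      (-1) ^+ #|class_in k S| * (-1) ^+ #|class_in k S :&: neg_edges sigma|.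
  move=> clk; rewrite (class_big _ tau0 clk) -!prodr_const.
  rewrite [X in _ * X]big_mkcond [X in X * _]big_mkcond [LHS]big_mkcond -big_split /=.
  apply: eq_bigr => e _; rewrite !inE; case: ((c e == k) && (_ \in S)) => //=.
  by rewrite /tau0 /= mul1r; case: (sigma_sgn e) => ->.
have -> : parity (ori i) (ori j) S set0 = (\prod_(v in S) ori i v) * \prod_(v in S) ori j v.
  by rewrite -big_split; apply: eq_bigr => v _; rewrite /sg inE mulr1.
rewrite !prodE // setIUl cardsU.
rewrite [X in (_ - X)%N](_ : _ = 0%N) ?subn0; last first.
  apply/eqP; rewrite cards_eq0; apply/eqP/setP => e; rewrite !inE.
  by apply/negP => /andP[/andP[/andP[/eqP-> _] _] /andP[/andP[]]]; rewrite (negbTE ij).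
have -> : #|class_in i S| = #|class_in j S|.
  by apply/eqP; rewrite -(eqn_pmul2r (isT : (0 < 2)%N)) -!class_in_card.
rewrite signr_odd exprD mulrACA -expr2 sqrr_sign mul1r //.
Qed.

(** * Circuits in two color classes correspond to orbits *)

Section PairCircuits.
Variables i j : 'I_3.
Hypothesis ij : i != j.

Local Notation orbit_of := (orb (mu i) (mu j)).

Definition pair_edges S : {set edge G} := class_in i S :|: class_in j S.

Lemma mem_class_in k S e : (e \in class_in k S) = (c e == k) && (ends e false \in S).
Proof. by rewrite in_set. Qed.

Lemma mem_pair_orb r h : (h.1 \in pair_edges (orbit_of r)) =
  ((c h.1 == i) || (c h.1 == j)) && (inc h \in orbit_of r).
Proof.
rewrite in_setU !mem_class_in -andb_orl; case: eqP => [ci|_] /=; last case: eqP => [cj|//] /=.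
  case: h ci => e [] //= ci; rewrite -[inc _]/(ends e (~~ false)) -(mu_ends e false) ci.
  by rewrite (orb_m1 (mu_matching i) (mu_matching j)).
case: h cj => e [] //= cj; rewrite -[inc _]/(ends e (~~ false)) -(mu_ends e false) cj.
by rewrite (orb_m2 (mu_matching i) (mu_matching j)).
Qed.

Lemma hf_pair_orb r v k : k \in [set i; j] -> v \in orbit_of r ->
  (hf k v).1 \in pair_edges (orbit_of r).
Proof.
by move=> /set2P kij vr; rewrite mem_pair_orb; have [-> ->] := hfP k v;
  case: kij => ->; rewrite eqxx ?orbT vr.
Qed.

Lemma pair_orb_deg r v :
  deg_in (pair_edges (orbit_of r)) v = if v \in orbit_of r then 2%N else 0%N.
Proof.
rewrite /deg_in; case: ifP => vr.
  rewrite (_ : [set h in _ | _] = [set hf i v; hf j v]).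
    rewrite cards2; suff -> : hf i v != hf j v by [].
    apply: contraNneq ij => e; have [_ ci] := hfP i v; have [_ cj] := hfP j v.
    by rewrite -ci -cj e.
  apply/setP => h; rewrite in_set in_set2 mem_pair_orb in_set.
  apply/idP/orP => [/and3P[/eqP <- /orP[]/eqP e _]|hv].
  - by left; rewrite -e hf_eq.
  - by right; rewrite -e hf_eq.
  - by case: hv => /eqP ->; [have [-> ->] := hfP i v|have [-> ->] := hfP j v];
      rewrite !eqxx ?orbT vr.
apply/eqP; rewrite cards_eq0; apply/eqP/setP => h; rewrite in_set0 in_set mem_pair_orb in_set.
by apply/negP => /and3P[/eqP -> _]; rewrite vr.
Qed.

Lemma adj_mu (C : {set edge G}) k v : (hf k v).1 \in C -> adj_in C v (mu k v).
Proof.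
move=> hC; apply/exists_inP; exists (hf k v).1 => //; apply/existsP.
exists (hf k v).2; rewrite -[ends _ (~~ _)]/(mu k v) eqxx andbT.
by apply/eqP; exact: (hfP k v).1.
Qed.

Lemma pair_orb_circuit r : circuit (pair_edges (orbit_of r)).
Proof.
apply/and3P; split.
- apply/set0Pn; exists (hf i r).1; apply: hf_pair_orb; rewrite ?orb_refl //.
  by rewrite in_set2 eqxx.
- by apply/forallP => v; rewrite pair_orb_deg; case: ifP.
apply/forallP => v; apply/forallP => w; rewrite !pair_orb_deg.
case: ifP => // vr; case: ifP => // wr /=.
have: w \in orbit_of v by rewrite (orb_eq (mu_matching i) (mu_matching j) vr).
rewrite inE => /connectP[p]; elim: p v vr => [|x p IH] v vr /= => [_ -> //|].
case/andP=> vx px e.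
have [adj xr] : adj_in (pair_edges (orbit_of r)) v x /\ x \in orbit_of r.
  case/orP: vx => /eqP ->.
    split; last by rewrite (orb_m1 (mu_matching i) (mu_matching j)).
    by apply/adj_mu/hf_pair_orb => //; rewrite in_set2 eqxx.
  split; last by rewrite (orb_m2 (mu_matching i) (mu_matching j)).
  by apply/adj_mu/hf_pair_orb => //; rewrite in_set2 eqxx orbT.
exact: connect_trans (connect1 adj) (IH x xr px e).
Qed.

(** A vertex has just two edges of these colors, so degree 2 puts both into [C]: the vertices of [C]
    are closed under both matchings, and connectivity confines them to one orbit. *)
Lemma circuit_pair_orb (C : {set edge G}) : C \subset color_class c i :|: color_class c j ->
  circuit C -> exists r, C = pair_edges (orbit_of r).
Proof.
move=> /subsetP subC /and3P[/set0Pn[e eC] /forallP deg /forallP conn].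
have col x : x \in C -> (c x == i) || (c x == j).
  by move/subC; rewrite in_setU !in_set !val_eqE.
have degP h : h.1 \in C -> (0 < deg_in C (inc h))%N.
  by move=> hC; apply/card_gt0P; exists h; rewrite !in_set eqxx.
have both v : (0 < deg_in C v)%N -> (hf i v).1 \in C /\ (hf j v).1 \in C.
  move=> dv; have /orP[/eqP d0|/eqP d2] := deg v; first by rewrite d0 in dv.
  have sub : [set h in half_at v | h.1 \in C] \subset [set hf i v; hf j v].
    apply/subsetP => h; rewrite in_set in_set2 in_set => /andP[/eqP <- /col /orP[]/eqP <-];
    by rewrite hf_eq eqxx ?orbT.
  have : [set h in half_at v | h.1 \in C] = [set hf i v; hf j v].
    apply/eqP; rewrite eqEcard sub -/(deg_in C v) d2 cards2.
    by case: (_ != _).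
  move/setP => eqs; split.
    by have := eqs (hf i v); rewrite in_set in_set2 eqxx => /andP[].
  by have := eqs (hf j v); rewrite in_set in_set2 eqxx orbT => /andP[].
pose r := ends e false; exists r.
have subA v : v \in orbit_of r -> (0 < deg_in C v)%N.
  move: v; apply/subsetP; pose A := [set v | (0 < deg_in C v)%N].
  suff : orbit_of r \subset A.
    by move=> sA; apply/subsetP => v /(subsetP sA); rewrite in_set.
  apply: orb_min; first by rewrite in_set; apply: (degP (e, false)).
  move=> v; rewrite in_set => /both[hi hj]; rewrite !in_set.
  by split; apply: (degP (opp (hf _ v))).
apply/setP => x; apply/idP/idP => [xC|]; last first.
  rewrite -[x]/((x, false).1) mem_pair_orb /= => /andP[cx /subA /both].
  case=> hi hj; have e1 := hf_eq (x, false); rewrite /= in e1.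
  by case/orP: cx => /eqP cx; rewrite cx in e1; [rewrite e1 in hi|rewrite e1 in hj].
rewrite -[x]/((x, false).1) mem_pair_orb /= col //=.
have := conn r => /forallP/(_ (ends x false))/implyP/(_ (degP (e, false) eC)).
move=> /implyP/(_ (degP (x, false) xC)).
case/connectP => p pr el; rewrite -[inc _]/(ends x false) el.
suff walkC q v : v \in orbit_of r -> path (adj_in C) v q ->
    last v q \in orbit_of r by apply: walkC pr; apply: orb_refl.
elim: q v => [|w q IH] v vr //= /andP[vw]; apply: IH.
case/exists_inP: vw => y yC /existsP[b /andP[/eqP yv /eqP <-]].
rewrite -mu_ends yv; case/orP: (col y yC) => /eqP ->.
  by rewrite (orb_m1 (mu_matching i) (mu_matching j)).
by rewrite (orb_m2 (mu_matching i) (mu_matching j)).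
Qed.

Definition unbalanced_orbits : {set {set V}} :=
  [set O in [set orbit_of v | v : V] | parity (ori i) (ori j) O set0 == -1].

Lemma num_unbalanced_orbits :
  num_unbalanced_circuits sigma (color_class c i :|: color_class c j) =
  #|unbalanced_orbits|.
Proof.
have unbE r : unbalanced sigma (pair_edges (orbit_of r)) =
    (parity (ori i) (ori j) (orbit_of r) set0 == -1).
  rewrite parity_odd // => [|v vr]; last first.
    by rewrite (orb_m1 (mu_matching i) (mu_matching j))
      (orb_m2 (mu_matching i) (mu_matching j)).
  by rewrite /unbalanced /pair_edges; case: odd.
rewrite /num_unbalanced_circuits -(card_in_imset (f := pair_edges)); last first.
  move=> O O'; rewrite !in_set => /andP[/imsetP[r _ ->] _] /andP[/imsetP[r' _ ->] _] e.
  have := hf_pair_orb (r := r) (v := r) (set21 i j) (orb_refl _ _ r).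
  rewrite e mem_pair_orb; have [-> _] := hfP i r => /andP[_ rr'].
  by rewrite (orb_eq (mu_matching i) (mu_matching j) rr').
apply: eq_card => C; rewrite in_set; apply/and3P/imsetP => [[sC cC uC]|[O]].
  have [r eC] := circuit_pair_orb sC cC; exists (orbit_of r) => //.
  by rewrite !in_set -unbE -eC uC andbT; apply/imsetP; exists r.
rewrite in_set => /andP[/imsetP[r _ ->]]; rewrite -unbE => uO ->; split=> //.
  apply/subsetP => e; rewrite -[e]/((e, false).1) mem_pair_orb /= => /andP[ce _].
  by rewrite in_setU !in_set !val_eqE.
exact: pair_orb_circuit.
Qed.

Lemma parity_orbits :
  parity (ori i) (ori j) setT set0 = (-1) ^+ odd #|unbalanced_orbits|.
Proof.
rewrite /parity (partition_big orbit_of (mem [set orbit_of v | v : V])) /=; last first.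
  by move=> v _; apply: imset_f.
rewrite signr_odd -prodr_const [RHS]big_mkcond /= [LHS]big_mkcond /=.
apply: eq_bigr => O _; rewrite in_set; case: ifP => //= /imsetP[r _ ->].
transitivity (parity (ori i) (ori j) (orbit_of r) set0).
  apply: eq_bigl => v; rewrite in_setT /=; apply/eqP/idP => [<-|]; first exact: orb_refl.
  exact: (orb_eq (mu_matching i) (mu_matching j)).
by case: (parity_sgn (ori_sgn i) (ori_sgn j) (orbit_of r) set0) => ->.
Qed.
End PairCircuits.
End ColoredGraph.

(** * Counting unbalanced circuits and the final case distinction *)

Lemma nz_flow_weaken (V : finType) (ma mb mc : V -> V) (oa ob oc : V -> int) (k l : int) :
  k <= l -> nz_flow ma mb mc oa ob oc k -> nz_flow ma mb mc oa ob oc l.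
Proof.
move=> kl [Fa [Fb [Fc [hF bF]]]]; exists Fa, Fb, Fc; split=> // v.
by have [? ? ?] := bF v; split; lia.
Qed.

Section ParityCount.
Variables (G : mgraph) (sigma : edge G -> int) (c : edge G -> 'I_3).
Hypotheses (hsigma : signature sigma) (hc : proper_edge_coloring c).
Variable hf : 'I_3 -> vert G -> Defs.half G.
Hypothesis hfP : forall k v, inc (hf k v) = v /\ c (hf k v).1 = k.
Variables i j : 'I_3.
Hypothesis ij : i != j.

Local Notation par S := (parity (ori sigma hf i) (ori sigma hf j) S set0).
Local Notation orbit_of := (orb (mu hf i) (mu hf j)).
Local Notation num :=
  (num_unbalanced_circuits sigma (color_class c i :|: color_class c j)).

Lemma num_unbalanced_eq0 : (forall v, par (orbit_of v) = 1) -> num = 0%N.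
Proof.
move=> bal; rewrite (num_unbalanced_orbits hsigma hc hfP ij).
apply/eqP; rewrite cards_eq0; apply/eqP/setP => O; rewrite in_set0 in_set.
by apply/negP => /andP[/imsetP[r _ ->]]; rewrite bal.
Qed.

Lemma num_unbalanced_odd_ge3 : par setT = -1 ->
  (exists x y, [/\ par (orbit_of x) = -1, par (orbit_of y) = -1 & y \notin orbit_of x]) ->
  odd num /\ (3 <= num)%N.
Proof.
rewrite (parity_orbits hsigma hc hfP) (num_unbalanced_orbits hsigma hc hfP ij).
move=> par1 [x [y [ux uy yx]]]; set U := unbalanced_orbits _ _ _ _ in par1 *.
have oddU : odd #|U| by move: par1; case: odd.
(* An odd number greater than 1 is at least 3. *)
split=> //; suff : (1 < #|U|)%N by case: #|U| oddU => [|[|[|]]].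
have inU v : par (orbit_of v) = -1 -> orbit_of v \in U.
  by move=> uv; rewrite in_set uv eqxx andbT imset_f.
apply/card_gt1P; exists (orbit_of x), (orbit_of y); split; rewrite ?inU //.
by apply: contraNneq yx => ->; apply: orb_refl.
Qed.

Lemma parity_classes :
  #|color_class c i :&: neg_edges sigma| = #|color_class c j :&: neg_edges sigma| %[mod 2] ->
  par setT = 1.
Proof.
move=> eqmod; rewrite (parity_odd hsigma hc hfP ij) => [|v _]; last by rewrite !in_setT.
have classT k : class_in c k setT = color_class c k.
  by apply/setP => e; rewrite !in_set andbT val_eqE.
rewrite !classT setIUl cardsU [X in (_ - X)%N](_ : _ = 0%N).
  move: eqmod; rewrite subn0 oddD !modn2.
  by case: odd; case: odd.
apply/eqP; rewrite cards_eq0; apply/eqP/setP => e; rewrite !in_set.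
by apply/negP => /andP[/andP[/eqP ei _] /andP[/eqP ej _]];
  case/eqP: ij; apply: val_inj; rewrite /= -ei.
Qed.
End ParityCount.

Close Scope ring_scope.
Unset Implicit Arguments.

Theorem theorem1p3 (G : mgraph) (sigma : edge G -> int)
    (c : edge G -> 'I_3) (R B Y : {set edge G})
    (hsigma : signature sigma)
    (hconn : connected G) (hcubic : cubic G)
    (hc : proper_edge_coloring c)
    (hR : R = color_class c 0) (hB : B = color_class c 1)
    (hY : Y = color_class c 2)
    (hRB : #|R :&: neg_edges sigma| = #|B :&: neg_edges sigma| %[mod 2])
    (hadm : flow_admissible sigma) :
  let exceptional :=
    [/\ num_unbalanced_circuits sigma (R :|: B) = 0,
        odd (num_unbalanced_circuits sigma (R :|: Y)) /\
          3 <= num_unbalanced_circuits sigma (R :|: Y) &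
        odd (num_unbalanced_circuits sigma (B :|: Y)) /\
          3 <= num_unbalanced_circuits sigma (B :|: Y)] in
  (~ exceptional -> has_nowhere_zero_flow sigma 8) /\
  (exceptional -> has_nowhere_zero_flow sigma 10).
Proof.
move=> exceptional; have [hf hfP] := half_exists hcubic hc.
have mm := mu_matching hc hfP; have os := ori_sgn hsigma hf.
have flow_of (k : nat) := nz_flow_graph hsigma hc hfP (k := k).
have conn := mu_linked hc hfP hconn.
have p01 : parity (ori sigma hf c0) (ori sigma hf c1) setT set0 = 1%R.
  by apply: (parity_classes hsigma hc hfP) => //; rewrite -hR -hB.
have p10 : parity (ori sigma hf c1) (ori sigma hf c0) setT set0 = 1%R.
  by apply: (parity_classes hsigma hc hfP) => //; rewrite -hR -hB.
have [F0 [F1 [F2 [hF nzF]]]] := admissible_half_flow hc hfP hadm.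
(* The bound 7 settles both claims, as an 8-flow is also a 10-flow. *)
have small : nz_flow (mu hf c0) (mu hf c1) (mu hf c2) (ori sigma hf c0) (ori sigma hf c1)
    (ori sigma hf c2) 7 ->
    (~ exceptional -> has_nowhere_zero_flow sigma 8) /\
    (exceptional -> has_nowhere_zero_flow sigma 10).
  move=> nz; split=> _; first exact: (flow_of 7).
  by apply: (flow_of 9); apply: nz_flow_weaken nz.
have [|/small//|[nz9 bal01 p02 two02]] :=
    nz8_or_nz10 (mm c0) (mm c1) (mm c2) (os c0) (os c1) (os c2) conn p01.
  by exists F0, F1, F2.
(* The exchange of the first two colors yields the conditions on the pair B, Y. *)
have [|/nz_flow_swap/small//|[_ _ p12 two12]] :=
    nz8_or_nz10 (mm c1) (mm c0) (mm c2) (os c1) (os c0) (os c2) (linked_swap conn) p10.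
  exists F1, F0, F2; split; first exact: hflow_swap.
  by move=> v; have [] := nzF v.
split=> [nexc|_]; last exact: (flow_of 9).
case: nexc; rewrite /exceptional hR hB hY; split.
- exact: (num_unbalanced_eq0 hsigma hc hfP (i := c0) (j := c1)).
- exact: (num_unbalanced_odd_ge3 hsigma hc hfP (i := c0) (j := c2)).
- exact: (num_unbalanced_odd_ge3 hsigma hc hfP (i := c1) (j := c2)).
Qed.
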